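(* Let $\mathcal{A}$ be an arbitrary unital associative complex algebra and $A,B\in\mathcal{A}$. For all $\delta,\epsilon\in\,]0,1/4]$ the parallel transport ${}^{\Gamma(B,A)}W^{(c_{(\delta\epsilon)})}_{10}\in\mathcal{A}[[\lambda]]$ along the affine path $c_{(\delta\epsilon)}$ from $\delta$ to $1-\epsilon$ factorizes as $$ {}^{\Gamma(B,A)}W^{(c_{(\delta\epsilon)})}_{10} = e^{\lambda\ln(\epsilon)B}\;\Phi_{\delta,\epsilon}(A,B)\;e^{-\lambda\ln(\delta)A}, \qquad\text{where}\qquad \Phi_{\delta,\epsilon}(A,B):=\psi_\epsilon(B,A)\,\bigl(\psi_\delta(A,B)\bigr)^{-1}. $$ Moreover the limit $$ \Phi(A,B):=\lim_{(\delta,\epsilon)\to(0,0)}\Phi_{\delta,\epsilon}(A,B)\in\mathcal{A}[[\lambda]] $$ exists (it is called the Drinfel'd associator with respect to $A,B$).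
   Context: $\mathcal{A}[[\lambda]]$ is the algebra of formal power series in the formal parameter $\lambda$ with coefficients in $\mathcal{A}$; for $X\in\mathcal{A}$ and $t\in\mathbb{C}$, $e^{\lambda tX}=\sum_{r\ge0}\frac{\lambda^r t^r}{r!}X^r$. For $A,B\in\mathcal{A}$ let $\Gamma(B,A)(x)=\left(\frac1xA+\frac1{x-1}B\right)\mathsf{d}x$, a formal connection on $]0,1[$. For a smooth path $c:[0,1]\to\,]0,1[$, the parallel transport ${}^{\Gamma(B,A)}W^{(c)}_{10}$ is the value at $s=1$ of the unique solution $s\mapsto W_s\in\mathcal{A}[[\lambda]]$ (whose coefficient at each power of $\lambda$ lies in $\mathcal{C}^\infty([0,1],\mathbb{C})\otimes\mathcal{A}$, algebraic tensor product) of $$\frac{\mathsf{d}W_s}{\mathsf{d}s}=\lambda\left(\frac{1}{c(s)}A+\frac1{c(s)-1}B\right)\frac{\mathsf{d}c}{\mathsf{d}s}(s)\,W_s,\qquad W_0=1 .$$ For $\delta,\epsilon\in\,]0,1/4]$ the affine path is $c_{(\delta\epsilon)}(s)=\delta+s(1-\delta-\epsilon)$, $s\in[0,1]$, joining $\delta$ to $1-\epsilon$. The exponential half-path is $\tilde c_{(2,\epsilon)}(s)=1-\frac12e^{\ln(2\epsilon)s}$, joining $\frac12$ to $1-\epsilon$. The element $\psi_\epsilon(B,A)\in\mathcal{A}[[\lambda]]$ is defined by ${}^{\Gamma(B,A)}W^{(\tilde c_{(2,\epsilon)})}_{10}=e^{\lambda\ln(\epsilon)B}\,\psi_\epsilon(B,A)$;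 it has constant term $1$, hence is invertible. $\psi_\delta(A,B)$ is the same expression with $A$ and $B$ exchanged and $\epsilon$ replaced by $\delta$, i.e. ${}^{\Gamma(A,B)}W^{(\tilde c_{(2,\delta)})}_{10}=e^{\lambda\ln(\delta)A}\,\psi_\delta(A,B)$ with $\Gamma(A,B)(x)=\left(\frac1xB+\frac1{x-1}A\right)\mathsf{d}x$. Limits: the coefficient of $\lambda^r$ of $(\delta,\epsilon)\mapsto\Phi_{\delta,\epsilon}(A,B)$ lies in $\mathrm{Fun}(]0,1/4]^2,\mathbb{C})\otimes\mathcal{A}$ (algebraic tensor product; $\mathrm{Fun}(M,\mathbb{C})$ denotes all functions $M\to\mathbb{C}$), so it takes values in a finite-dimensional subspace of $\mathcal{A}$. The limit is taken separately for each power of $\lambda$, with respect to an arbitrary norm on the complex vector space $\mathcal{A}$ (the choice does not matter). *)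

(* Defs.v *)
From HB Require Import structures.
From mathcomp Require Import all_boot all_order all_algebra.
From mathcomp Require Import complex.
From mathcomp Require Import all_classical all_reals all_analysis.

Set Implicit Arguments.
Unset Strict Implicit.
Unset Printing Implicit Defensive.

Import Order.TTheory GRing.Theory Num.Theory.
Import numFieldNormedType.Exports.

Local Open Scope classical_set_scope.
Local Open Scope ring_scope.
Local Open Scope complex_scope.

(* A record rather than an alias of [nat -> T], on which MathComp-Analysis
   already puts the pointwise ring structure. *)
Record fps (T : Type) := Fps { fcoef :> nat -> T }.

Lemma fpsP (T : Type) (x y : fps T) : (forall n, x n = y n) <-> x = y.
Proof.
split=> [|->//]; case: x y => [x] [y] /= xy; congr Fps; exact/funext.
Qed.

HB.instance Definition _ (T : Type) := gen_eqMixin (fps T).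
HB.instance Definition _ (T : Type) := gen_choiceMixin (fps T).

Section FpsRing.
Variable T : nzRingType.
Implicit Types x y z : fps T.

Definition fps_zero : fps T := Fps (fun=> 0).
Definition fps_opp x : fps T := Fps (fun n => - x n).
Definition fps_add x y : fps T := Fps (fun n => x n + y n).

Lemma fps_addA : associative fps_add.
Proof. by move=> x y z; apply/fpsP => n; apply: addrA. Qed.
Lemma fps_addC : commutative fps_add.
Proof. by move=> x y; apply/fpsP => n; apply: addrC. Qed.
Lemma fps_add0 : left_id fps_zero fps_add.
Proof. by move=> x; apply/fpsP => n; apply: add0r. Qed.
Lemma fps_addN : left_inverse fps_zero fps_opp fps_add.
Proof. by move=> x; apply/fpsP => n; apply: addNr. Qed.

HB.instance Definition _ :=
  GRing.isZmodule.Build (fps T) fps_addA fps_addC fps_add0 fps_addN.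

Definition fconst (a : T) : fps T := Fps (fun n => if n == 0%N then a else 0).
Definition fps_mul x y : fps T :=
  Fps (fun n => \sum_(i < n.+1) x i * y (n - i)%N).

Lemma fps_mul_rev x y n :
  fps_mul x y n = \sum_(i < n.+1) x (n - i)%N * y i.
Proof.
rewrite /= (reindex_inj rev_ord_inj) /=.
by apply: eq_bigr => i _; rewrite (sub_ordK i).
Qed.

Lemma fps_mulA : associative fps_mul.
Proof.
move=> x y z; apply/fpsP => n; rewrite [RHS]fps_mul_rev.
pose F (j k : nat) := x j * (y (n - j - k)%N * z k).
transitivity (\sum_(j < n.+1) \sum_(k < n.+1 | (k <= n - j)%N) F j k).
  apply: eq_bigr => j _; rewrite [X in _ * X]fps_mul_rev big_distrr /=.
  by rewrite (big_ord_narrow_leq (leq_subr _ _)).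
rewrite (exchange_big_dep predT) //=; apply: eq_bigr => k _.
transitivity (\sum_(j < n.+1 | (j <= n - k)%N) F j k).
  apply: eq_bigl => j; rewrite -ltnS -(ltnS j) -!subSn ?leq_ord //.
  by rewrite -subn_gt0 -(subn_gt0 j) -!subnDA addnC.
rewrite (big_ord_narrow_leq (leq_subr _ _)) big_distrl /=.
by apply: eq_bigr => j _; rewrite /F -!subnDA addnC mulrA.
Qed.

Lemma fps_mul1 : left_id (fconst 1) fps_mul.
Proof.
move=> x; apply/fpsP => n /=; rewrite big_ord_recl /= mul1r subn0 big1 ?addr0 //.
by move=> i _; rewrite mul0r.
Qed.

Lemma fps_mulr1 : right_id (fconst 1) fps_mul.
Proof.
move=> x; apply/fpsP => n /=; rewrite big_ord_recr /= subnn mulr1 big1 ?add0r //.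
by move=> i _; rewrite subn_eq0 leqNgt ltn_ord mulr0.
Qed.

Lemma fps_mulDl : left_distributive fps_mul fps_add.
Proof.
move=> x y z; apply/fpsP => n /=; rewrite -big_split /=.
by apply: eq_bigr => i _; rewrite mulrDl.
Qed.

Lemma fps_mulDr : right_distributive fps_mul fps_add.
Proof.
move=> x y z; apply/fpsP => n /=; rewrite -big_split /=.
by apply: eq_bigr => i _; rewrite mulrDr.
Qed.

Lemma fps_1neq0 : fconst 1 != fps_zero.
Proof.
by apply/eqP => /fpsP/(_ 0%N)/= /eqP; rewrite oner_eq0.
Qed.

HB.instance Definition _ := GRing.Zmodule_isNzRing.Build (fps T)
  fps_mulA fps_mul1 fps_mulr1 fps_mulDl fps_mulDr fps_1neq0.

Lemma fcoef1 n : (1 : fps T) n = (n == 0%N)%:R.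
Proof. by rewrite /GRing.one /=; case: eqP. Qed.
Lemma fcoefD x y n : (x + y) n = x n + y n. Proof. by []. Qed.
Lemma fcoefN x n : (- x) n = - x n. Proof. by []. Qed.
Lemma fcoefM x y n : (x * y) n = \sum_(i < n.+1) x i * y (n - i)%N.
Proof. by []. Qed.

Definition fps_has_inv x := exists y, y * x = 1 /\ x * y = 1.
Definition fps_unit : {pred fps T} := fun x => `[< fps_has_inv x >].
Definition fps_inv x : fps T :=
  if pselect (fps_has_inv x) is left h then projT1 (cid h) else x.

Lemma fps_mulVx : {in fps_unit, left_inverse 1 fps_inv *%R}.
Proof.
by move=> x /asboolP h; rewrite /fps_inv; case: pselect => // h'; case: cid => y [].
Qed.
Lemma fps_mulxV : {in fps_unit, right_inverse 1 fps_inv *%R}.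
Proof.
by move=> x /asboolP h; rewrite /fps_inv; case: pselect => // h'; case: cid => y [].
Qed.
Lemma fps_unitP x y : y * x = 1 /\ x * y = 1 -> fps_unit x.
Proof. by move=> h; apply/asboolP; exists y. Qed.
Lemma fps_inv_out : {in [predC fps_unit], fps_inv =1 id}.
Proof.
by move=> x; rewrite inE => /asboolP h; rewrite /fps_inv; case: pselect.
Qed.

HB.instance Definition _ := GRing.NzRing_hasMulInverse.Build (fps T)
  fps_mulVx fps_mulxV fps_unitP fps_inv_out.

Definition flambda : fps T := Fps (fun n => (n == 1%N)%:R).

Lemma fps_expn_small z : z 0%N = 0 -> forall k n, (n < k)%N -> (z ^+ k) n = 0.
Proof.
move=> z0; elim=> // k IHk n nk; rewrite exprS fcoefM big1 // => -[[|i] /= Hi] _.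
  by rewrite z0 mul0r.
by rewrite IHk ?mulr0 //; case: n nk Hi => // n nk Hi; rewrite subSS (leq_ltn_trans (leq_subr _ _)).
Qed.

Lemma fps_unit_coef0 x : x 0%N = 1 -> x \is a GRing.unit.
Proof.
move=> x0; pose z := 1 - x.
have z0 : z 0%N = 0 by rewrite fcoefD fcoefN fcoef1 x0 subrr.
pose S N : fps T := \sum_(k < N) z ^+ k.
pose y : fps T := Fps (fun n => S n.+1 n).
have yS n N : (n < N)%N -> y n = S N n.
  move=> /subnK <-; elim: (N - n.+1)%N => // m ->.
  rewrite addSn /S [in RHS]big_ord_recr /= fps_expn_small ?addr0 //.
  by rewrite addnS ltnS leq_addl.
have xS N : x * S N = 1 - z ^+ N.
  by rewrite -opprB subrX1 -mulNr opprB /z subKr.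
have Sx N : S N * x = 1 - z ^+ N.
  rewrite -xS; apply/esym; apply: commr_sum => k _; apply: commrX.
  by apply: commrB; [apply: commr1|].
have E N n : (n < N)%N -> (1 - z ^+ N) n = (1 : fps T) n.
  by move=> nN; rewrite fcoefD fcoefN fps_expn_small // subr0.
apply/asboolP; exists y; split; apply/fpsP => n.
  rewrite -(E n.+1) // -Sx !fcoefM; apply: eq_bigr => i _.
  by rewrite (yS i n.+1).
rewrite -(E n.+1) // -xS !fcoefM; apply: eq_bigr => i _.
by rewrite (yS _ n.+1) // ltnS leq_subr.
Qed.

End FpsRing.

Arguments flambda {T}.

Section Transport.
Variables (R : realType) (U : algType R[i]).

(* e^{lambda t X} *)
Definition fexp (t : R[i]) (X : U) : fps U :=
  Fps (fun r => (t ^+ r / r`!%:R) *: X ^+ r).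

(* Derivative of a function on [0, 1], one-sided at the end points; only the
   values of [f] on [0, 1] matter. *)
Definition diff_quot (f : R -> R) (s t : R) : R := (f t - f s) / (t - s).
Definition deriv01 (f : R -> R) (s : R) : R :=
  lim (diff_quot f s @ within `[0, 1] s^').
Definition smooth01 (f : R -> R) : Prop :=
  forall k s, s \in `[0, 1] ->
    cvg (diff_quot (iter k deriv01 f) s @ within `[0, 1] s^').

Definition cderiv01 (f : R -> R[i]) (s : R) : R[i] :=
  deriv01 (fun t => complex.Re (f t)) s +i* deriv01 (fun t => complex.Im (f t)) s.
Definition csmooth01 (f : R -> R[i]) : Prop :=
  smooth01 (fun t => complex.Re (f t)) /\ smooth01 (fun t => complex.Im (f t)).

(* On [0, 1], w is an element of the algebraic tensor product of
   C^oo([0, 1], C) and U, and w' is its image under d/ds (x) id. *)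
Definition tensor_deriv (w w' : R -> U) : Prop :=
  exists n (f : 'I_n -> R -> R[i]) (a : 'I_n -> U),
    (forall j, csmooth01 (f j)) /\
    (forall s, s \in `[0, 1] ->
       w s = \sum_j f j s *: a j /\ w' s = \sum_j cderiv01 (f j) s *: a j).

(* Gamma B A x is the coefficient of dx in the connection Gamma(B,A). *)
Definition Gamma (B A : U) (x : R) : U :=
  (x^-1)%:C *: A + ((x - 1)^-1)%:C *: B.

Definition is_transport (G : R -> U) (c : R -> R) (W : R -> fps U) : Prop :=
  W 0 = 1 /\
  (forall r, tensor_deriv (fun s => W s r)
     (fun s => (flambda * fconst ((deriv01 c s)%:C *: G (c s)) * W s) r)).

(* The value at 1 of the solution, which exists and is unique on [0, 1] when
   G is smooth on the image of the smooth path c. *)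
Definition transport (G : R -> U) (c : R -> R) : fps U :=
  xget (fun=> 0) [set W | is_transport G c W] 1.

Definition affine_path (delta epsilon s : R) : R :=
  delta + s * (1 - delta - epsilon).
Definition half_path (epsilon s : R) : R :=
  1 - 2^-1 * expR (ln (2 * epsilon) * s).

Definition psi (epsilon : R) (B A : U) : fps U :=
  (fexp (ln epsilon)%:C B)^-1 * transport (Gamma B A) (half_path epsilon).

Definition PhiDE (delta epsilon : R) (A B : U) : fps U :=
  psi epsilon B A * (psi delta A B)^-1.

Record is_norm (N : U -> R) : Prop := IsNorm {
  norm_triangle : forall x y, N (x + y) <= N x + N y ;
  norm_scale : forall (a : R[i]) x, (N (a *: x))%:C = `|a| * (N x)%:C ;
  norm_definite : forall x, N x = 0 -> x = 0 }.

Lemma fexp_unit t X : fexp t X \is a GRing.unit.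
Proof. by apply: fps_unit_coef0; rewrite /= expr0 fact0 divr1 scale1r expr0. Qed.

(* The equation by which psi is defined. *)
Lemma psiE epsilon B A :
  transport (Gamma B A) (half_path epsilon) =
  fexp (ln epsilon)%:C B * psi epsilon B A.
Proof. by rewrite /psi mulVKr // fexp_unit. Qed.

End Transport.

(* Main.v *)
Require Import Defs.
From HB Require Import structures.
From mathcomp Require Import all_boot all_order all_algebra.
From mathcomp Require Import complex ring lra.
From mathcomp Require Import all_classical all_reals all_analysis.
Import Order.TTheory GRing.Theory Num.Theory.
Import numFieldNormedType.Exports.
Local Open Scope classical_set_scope.
Local Open Scope ring_scope.
Local Open Scope complex_scope.

Set Implicit Arguments.
Unset Strict Implicit.
Unset Printing Implicit Defensive.

(** Let F be the solution on ]0,1[ of F' = lambda (A/x + B/(x-1)) F with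
    F(1/2) = 1; its coefficients are iterated integrals ([flow_exists]). Along
    a path c whose velocity is a smooth function of its position the transport
    is F(c(1)) F(c(0))^-1 ([transport_flow]), because the right hand side solves
    the defining equation and solutions are unique. Uniqueness reduces to the
    fact that an element of the tensor product of the smooth functions with the
    algebra is constant when its derivative vanishes ([tensor_der01_cst]).

    For the connection with A and B exchanged the solution is F(1-x), by the
    symmetry x -> 1-x ([flow_mirror], [flow_unique]). Hence psi_epsilon(B,A) is
    epsilon^(-lambda B) F(1-epsilon) and psi_delta(A,B) is
    delta^(-lambda A) F(delta), while the transport along the affine path is
    F(1-epsilon) F(delta)^-1. The factorization is then an identity in the
    group of units.

    For the limit put Y(x) = (1-x)^(-lambda B) F(x), so that psi_epsilon(B,A) is
    Y(1-epsilon). Conjugation by the exponential cancels the pole at 1: the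
    function Y satisfies
    Y' = lambda (1-x)^(-lambda B) (A/x) (1-x)^(lambda B) Y ([fder_gauge]), and
    the coefficients of this equation grow near 1 only like powers of ln(1-x).
    Such functions are integrable at 1 ([tder_log_primitive]), so that each
    coefficient of Y has a limit there, by induction on the degree
    ([tensor_regularized]). The same holds for
    psi_delta(A,B), hence for its inverse, whose coefficients are polynomials in
    those of psi_delta(A,B), and for the product. *)

(** * Iterated differentiability of real functions *)

Section SmoothFunctions.
Variable R : realType.
Implicit Types (D : set R) (f g p c : R -> R) (n : nat).

Definition has_deriv D f g := forall x, D x -> is_derive x 1 f (g x).

(** Existential rather than through a derivative operator: a function that is
    differentiable only on [D] has no canonical derivative off [D]. *)
Fixpoint nderivable D n f : Prop :=
  if n is m.+1 then exists2 g, has_deriv D f g & nderivable D m g else True.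

Definition smooth D f := forall n, nderivable D n f.

Lemma has_derivD D f f' g g' : has_deriv D f f' -> has_deriv D g g' ->
  has_deriv D (fun x => f x + g x) (fun x => f' x + g' x).
Proof. by move=> df dg x Dx; apply: is_deriveD (df x Dx) (dg x Dx). Qed.

Lemma has_derivN D f f' : has_deriv D f f' ->
  has_deriv D (fun x => - f x) (fun x => - f' x).
Proof. by move=> df x Dx; apply: is_deriveN (df x Dx). Qed.

Lemma has_derivM D f f' g g' : has_deriv D f f' -> has_deriv D g g' ->
  has_deriv D (fun x => f x * g x) (fun x => f' x * g x + f x * g' x).
Proof.
move=> df dg x Dx; apply: is_derive_eq (is_deriveM (df x Dx) (dg x Dx)) _.
by rewrite /GRing.scale /= addrC (mulrC (g x)).
Qed.

Lemma has_deriv_cst D a : has_deriv D (fun=> a) (fun=> 0).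
Proof. by move=> x _; apply: is_derive_cst. Qed.

Lemma has_deriv_id D : has_deriv D id (fun=> 1).
Proof. by move=> x _; apply: is_derive_id. Qed.

Lemma has_derivV D f f' : (forall x, D x -> f x != 0) -> has_deriv D f f' ->
  has_deriv D (fun x => (f x)^-1) (fun x => - ((f x)^-1 * (f x)^-1 * f' x)).
Proof.
move=> f0 df x Dx; apply: is_derive_eq (is_deriveV (f0 x Dx) (df x Dx)) _.
by rewrite /GRing.scale /= mulNr -exprVn expr2.
Qed.

Lemma has_deriv_comp D E f f' c c' : (forall x, D x -> E (c x)) ->
  has_deriv E f f' -> has_deriv D c c' ->
  has_deriv D (fun x => f (c x)) (fun x => f' (c x) * c' x).
Proof.
by move=> DE df dc x Dx; apply: (is_derive1_comp (df _ (DE x Dx)) (dc x Dx)).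
Qed.

Lemma has_deriv_eq D f g g' : has_deriv D f g ->
  (forall x, D x -> g x = g' x) -> has_deriv D f g'.
Proof. by move=> df e x Dx; rewrite -e //; apply: df. Qed.

Lemma has_deriv_continuous D f g x : has_deriv D f g -> D x ->
  {for x, continuous f}.
Proof.
move=> df /df [dfx _]; apply: differentiable_continuous.
exact/derivable1_diffP.
Qed.

Lemma nderivableW D n f : nderivable D n.+1 f -> nderivable D n f.
Proof. by elim: n f => // n IHn f [g df /IHn]; exists g. Qed.

Lemma nderivableD D n f g : nderivable D n f -> nderivable D n g ->
  nderivable D n (fun x => f x + g x).
Proof.
elim: n f g => // n IHn f g [f' df Cf] [g' dg Cg].
by exists (fun x => f' x + g' x); [exact: has_derivD|exact: IHn].
Qed.

Lemma nderivableN D n f : nderivable D n f -> nderivable D n (fun x => - f x).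
Proof.
elim: n f => // n IHn f [g df Cg].
by exists (fun x => - g x); [exact: has_derivN|exact: IHn].
Qed.

Lemma nderivableM D n f g : nderivable D n f -> nderivable D n g ->
  nderivable D n (fun x => f x * g x).
Proof.
elim: n f g => // n IHn f g Sf Sg.
have Cf := nderivableW Sf; have Cg := nderivableW Sg.
case: Sf Sg => f' df Cf' [g' dg Cg'].
exists (fun x => f' x * g x + f x * g' x); first exact: has_derivM.
by apply: nderivableD; apply: IHn.
Qed.

Lemma smoothD D f g : smooth D f -> smooth D g -> smooth D (fun x => f x + g x).
Proof. by move=> Sf Sg n; apply: nderivableD. Qed.

Lemma smoothN D f : smooth D f -> smooth D (fun x => - f x).
Proof. by move=> Sf n; apply: nderivableN. Qed.

Lemma smoothM D f g : smooth D f -> smooth D g -> smooth D (fun x => f x * g x).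
Proof. by move=> Sf Sg n; apply: nderivableM. Qed.

Lemma smooth_cst D a : smooth D (fun=> a).
Proof.
move=> n; elim: n a => // n IHn a; exists (fun=> 0) => //.
exact: has_deriv_cst.
Qed.

Lemma smooth_primitive D f g : has_deriv D f g -> smooth D g -> smooth D f.
Proof. by move=> df Sg [|n] //; exists g. Qed.

Lemma has_deriv_onem D : has_deriv D (fun x => 1 - x) (fun=> -1).
Proof.
apply: has_deriv_eq (has_derivD (has_deriv_cst 1) (has_derivN (@has_deriv_id D))) _.
by move=> x _; rewrite add0r.
Qed.

Lemma smooth_onem D : smooth D (fun x => 1 - x).
Proof. exact: (smooth_primitive (@has_deriv_onem D) (smooth_cst D (-1))). Qed.

Lemma smooth_id D : smooth D id.
Proof. exact: (smooth_primitive (@has_deriv_id D) (smooth_cst D 1)). Qed.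

Lemma smoothV D f : (forall x, D x -> f x != 0) -> smooth D f ->
  smooth D (fun x => (f x)^-1).
Proof.
move=> f0 Sf; elim=> // n IHn; case: (Sf n.+1) => f' df Cf'.
exists (fun x => - ((f x)^-1 * (f x)^-1 * f' x)); first exact: has_derivV.
by apply: nderivableN; apply: nderivableM => //; apply: nderivableM.
Qed.

(** The chain rule iterates because the velocity of the path is itself a
    function of the position. *)
Lemma nderivable_comp D E f p c n : (forall x, D x -> E (c x)) ->
  has_deriv D c (fun x => p (c x)) -> nderivable E n f -> smooth E p ->
  nderivable D n (fun x => f (c x)).
Proof.
move=> DE dc + Sp; elim: n f => // n IHn f [f' df Cf'].
exists (fun x => f' (c x) * p (c x)); first exact: has_deriv_comp df dc.
by apply: (IHn (fun x => f' x * p x)); apply: nderivableM.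
Qed.

Lemma has_deriv_MVT D f f' x y : is_interval D -> has_deriv D f f' ->
  D x -> D y -> x < y ->
  exists2 z, D z & f y - f x = f' z * (y - x).
Proof.
move=> iD df Dx Dy xy.
have sub z : z \in `[x, y] -> D z.
  by rewrite in_itv /=; apply: iD.
have [z zxy||z zxy E] := @MVT R f f' x y xy.
- by apply: df; apply: sub; apply: subset_itv_oo_cc zxy.
- apply: derivable_within_continuous => z zxy.
  by have [] := df z (sub z zxy).
- by exists z => //; apply: sub; apply: subset_itv_oo_cc zxy.
Qed.

Lemma has_deriv0_cst D f x y : is_interval D ->
  has_deriv D f (fun=> 0) -> D x -> D y -> f x = f y.
Proof.
move=> iD df; wlog xy : x y / x < y => [H Dx Dy|Dx Dy].
  by case: (ltgtP x y) => [xy|yx|->] //; [apply: H|apply/esym/H].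
have [z _ E] := has_deriv_MVT iD df Dx Dy xy.
by apply/esym/eqP; rewrite -subr_eq0 E mul0r.
Qed.

Lemma has_deriv_inj D f g f' x y : is_interval D ->
  has_deriv D f f' -> has_deriv D g f' -> D x -> D y -> f x = g x -> f y = g y.
Proof.
move=> iD df dg Dx Dy E.
have d0 : has_deriv D (fun x => f x - g x) (fun=> 0).
  apply: has_deriv_eq (has_derivD df (has_derivN dg)) _.
  by move=> z _; rewrite subrr.
have := has_deriv0_cst iD d0 Dx Dy.
by rewrite E subrr => /esym/eqP; rewrite subr_eq0 => /eqP.
Qed.

Lemma has_deriv_ge0 D f f' x y : is_interval D -> has_deriv D f f' ->
  (forall z, D z -> 0 <= f' z) -> D x -> D y -> x <= y -> f x <= f y.
Proof.
move=> iD df f'0 Dx Dy; rewrite le_eqVlt => /predU1P[->//|xy].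
have [z Dz E] := has_deriv_MVT iD df Dx Dy xy.
by rewrite -subr_ge0 E mulr_ge0 ?f'0 // subr_ge0 ltW.
Qed.

Definition I01 : set R := [set x | 0 < x < 1].

Lemma is_interval_oo a b : is_interval [set x : R | a < x < b].
Proof.
move=> x y /= /andP[ax xb] /andP[ay yb] z /andP[xz zy].
by rewrite (lt_le_trans ax) // (le_lt_trans zy).
Qed.

Lemma half01 : I01 2^-1.
Proof. by rewrite /I01 /=; lra. Qed.

(** The fundamental theorem of calculus gives a primitive on each compact
    subinterval from a to 1 - a; those that vanish at 1/2 fit together. *)
Lemma primitive01 f : smooth I01 f -> exists g, has_deriv I01 g f.
Proof.
move=> Sf.
have cf : {in I01, continuous f}.
  move=> x; rewrite inE => Ix; have [f' df _] := Sf 1%N.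
  exact: has_deriv_continuous df Ix.
have loc a : 0 < a < 2^-1 ->
    exists2 g, has_deriv [set x | a < x < 1 - a] g f & g 2^-1 = 0.
  move=> /andP[a0 a2].
  have subI x : a <= x <= 1 - a -> x \in I01.
    by move=> /andP[ax xa]; rewrite inE /I01 /=; lra.
  pose F x := (\int[lebesgue_measure]_(t in `[a, x]) f t)%R.
  exists (fun x => F x + - F 2^-1); last by rewrite subrr.
  move=> x /= /andP[ax xa].
  have fi : lebesgue_measure.-integrable `[a, 1 - a] (EFin \o f).
    apply: continuous_compact_integrable; first exact: segment_compact.
    apply: continuous_in_subspaceT => z; rewrite inE /= in_itv /= => za.
    exact: cf (subI z za).
  have cfx : {for x, continuous f} by apply: cf; apply: subI; rewrite !ltW.
  have [dF EF] := continuous_FTC1_closed xa fi ax cfx.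
  have dFx : is_derive x 1 F (f x) by apply: (DeriveDef dF); rewrite -derive1E.
  apply: is_derive_eq (is_deriveD dFx (is_derive_cst (- F 2^-1) x 1)) _.
  by rewrite addr0.
(* a margin: 1/2 and x both lie in ]m x, 1 - m x[ *)
pose m (x : R) := Num.min x (1 - x) / 2.
have m_itv x : I01 x -> [/\ 0 < m x < 2^-1, m x < 2^-1 < 1 - m x
                          & m x < x < 1 - m x].
  rewrite /I01 /= /m => /andP[x0 x1].
  by have [?|?] := leP x (1 - x); split; apply/andP; split; lra.
pose G x := if pselect (0 < m x < 2^-1) is left h then
  projT1 (cid2 (loc (m x) h)) x else 0.
exists G => x Ix; have [h hh hx] := m_itv x Ix.
have [g dg g0] := loc _ h.
apply: (near_eq_is_derive (f := g)); last exact: dg.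
have : \forall y \near x, m x < y < 1 - m x.
  by near=> y; apply/andP; split; near: y;
    [apply: lt_nbhsr|apply: lt_nbhsl]; case/andP: hx.
apply: filterS => y hy.
have Iy : I01 y by case/andP: h => ? ?; case/andP: hy => ? ?; rewrite /I01 /=; lra.
have [k kk ky] := m_itv y Iy.
rewrite /G; case: pselect => // k'; case: cid2 => g' /= dg' g'0.
pose D := [set z | Num.max (m x) (m y) < z < Num.min (1 - m x) (1 - m y)].
have DE z : D z <-> (m x < z < 1 - m x) /\ (m y < z < 1 - m y).
  rewrite /D /= gt_max lt_min; split.
    by move=> /andP[/andP[-> ->] /andP[-> ->]].
  by move=> [/andP[-> ->] /andP[-> ->]].
have iD : is_interval D by apply: is_interval_oo.
apply: (has_deriv_inj iD (x := 2^-1) (f' := f)).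
- by move=> z /DE[/dg].
- by move=> z /DE[_ /dg'].
- exact/DE.
- exact/DE.
- by rewrite g0.
Unshelve. all: by end_near.
Qed.

End SmoothFunctions.
Arguments I01 {R}.

(** * Logarithmic growth at 1 *)

Section LogBounded.
Variable R : realType.
Implicit Types (f g : R -> R).

(** The summand 1 keeps the base of the power at least 1, so that the exponent
    may be enlarged. *)
Definition log_bounded f := exists C k, 0 <= C /\
  forall x, 2^-1 <= x < 1 -> `|f x| <= C * (1 - ln (1 - x)) ^+ k.

Lemma one_sub_ln_ge1 (x : R) : 2^-1 <= x < 1 -> 1 <= 1 - ln (1 - x).
Proof.
move=> /andP[x2 x1]; rewrite lerDl oppr_ge0 ln_le0 //; lra.
Qed.

Lemma log_boundedM f g : log_bounded f -> log_bounded g ->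
  log_bounded (fun x => f x * g x).
Proof.
move=> [C [k [C0 fC]]] [C' [k' [C'0 gC']]].
exists (C * C'), (k + k')%N; split=> [|x hx]; first exact: mulr_ge0.
by rewrite normrM exprD mulrACA ler_pM // ?fC ?gC'.
Qed.

Lemma bounded_log_bounded f C :
  (forall x, 2^-1 <= x < 1 -> `|f x| <= C) -> log_bounded f.
Proof.
move=> fC; exists C, 0%N; split=> [|x /fC]; last by rewrite expr0 mulr1.
by apply: le_trans (fC 2^-1 _); rewrite ?normr_ge0 // lexx /=; lra.
Qed.

Lemma log_bounded_ln : log_bounded (fun x => ln (1 - x)).
Proof.
exists 1, 1%N; split=> // x hx; rewrite mul1r expr1 ler0_norm; first lra.
by have := one_sub_ln_ge1 hx; lra.
Qed.

(** Twice the square root of 1 - x: bounded and monotone, while its derivative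
    dominates every power of the logarithm near 1. This makes it a comparison
    function for primitives of functions of logarithmic growth. *)
Definition sqrt1m (x : R) := 2 * expR (ln (1 - x) / 2).

Lemma has_deriv_ln1m :
  has_deriv I01 (fun x : R => ln (1 - x)) (fun x => - (1 - x)^-1).
Proof.
pose E : set R := [set y | 0 < y].
have dln : has_deriv E (@ln R) (fun y => y^-1) by move=> y y0; apply: is_derive1_ln.
have sub x : I01 x -> E (1 - x) by rewrite /E /= subr_gt0 => /andP[].
apply: has_deriv_eq (has_deriv_comp sub dln (@has_deriv_onem R _)) _.
by move=> x _; rewrite mulrN1.
Qed.

Lemma smooth_onemV : smooth I01 (fun x : R => (1 - x)^-1).
Proof.
by apply: smoothV (@smooth_onem _ _) => x /andP[_ x1]; rewrite gt_eqF // subr_gt0.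
Qed.

Lemma smooth_ln1m : smooth I01 (fun x : R => ln (1 - x)).
Proof. exact: smooth_primitive has_deriv_ln1m (smoothN smooth_onemV). Qed.

Lemma has_deriv_sqrt1m :
  has_deriv I01 sqrt1m (fun x => - expR (- (ln (1 - x) / 2))).
Proof.
pose E : set R := setT.
have dexp : has_deriv E (@expR R) (@expR R) by move=> y _; apply: is_derive_expR.
have := has_derivM (has_deriv_cst 2) (has_deriv_comp (D := I01) (fun _ _ => I) dexp
  (has_derivM has_deriv_ln1m (has_deriv_cst 2^-1))).
move=> d; apply: has_deriv_eq d _ => x /andP[x0 x1].
rewrite mul0r mulr0 addr0 add0r.
have x10 : 0 < 1 - x by lra.
have e : 1 - x = expR (ln (1 - x) / 2) * expR (ln (1 - x) / 2).
  by rewrite -expRD -splitr lnK.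
rewrite [X in - X^-1]e expRN.
have e0 : expR (ln (1 - x) / 2) != 0 by rewrite gt_eqF // expR_gt0.
by field; rewrite e0.
Qed.

(** Raising [t <= expR t] to a power, at t a multiple of the logarithm. *)
Lemma log_bounded_le_expR g : log_bounded g -> exists2 C, 0 <= C &
  forall x, 2^-1 <= x < 1 -> `|g x| <= C * expR (- (ln (1 - x) / 2)).
Proof.
move=> [C [k [C0 gC]]].
pose m : R := (2 * k.+1)%:R.
have m0 : 0 < m by rewrite ltr0n.
exists (C * (m ^+ k.+1 * expR (2^-1))) => [|x hx].
  by rewrite !mulr_ge0 ?exprn_ge0 ?expR_ge0 // ltW.
apply: le_trans (gC x hx) _; rewrite -mulrA ler_wpM2l // -mulrA -expRD.
set l := 1 - ln (1 - x).
have l1 : 1 <= l by apply: one_sub_ln_ge1.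
apply: (@le_trans _ _ (l ^+ k.+1)); first by rewrite ler_weXn2l.
have -> : 2^-1 - ln (1 - x) / 2 = k.+1%:R * (l / m).
  rewrite /l /m natrM.
  by field; rewrite addrC natr1 pnatr_eq0.
have l0 : 0 <= l by apply: le_trans l1.
rewrite expRM_natl -exprMn; apply: lerXn2r.
- by rewrite nnegrE.
- by rewrite nnegrE mulr_ge0 ?expR_ge0 // ltW.
rewrite -ler_pdivrMl // mulrC; apply: le_trans (expR_ge1Dx _).
by rewrite lerDr.
Qed.

Lemma primitive_variation g g' : has_deriv I01 g g' -> log_bounded g' ->
  exists2 C, 0 <= C & forall x y, 2^-1 <= x -> x <= y -> y < 1 ->
    `|g y - g x| <= C * (sqrt1m x - sqrt1m y).
Proof.
move=> dg /log_bounded_le_expR[C C0 gC]; exists C => // x y x2 xy y1.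
pose D : set R := [set z | 2^-1 <= z < 1].
have iD : is_interval D.
  move=> a b /= /andP[? ?] /andP[? ?] c /andP[? ?].
  by apply/andP; split; lra.
have DI z : D z -> I01 z by move=> /andP[? ?]; apply/andP; split; lra.
have Dx : D x by apply/andP; split; lra.
have Dy : D y by apply/andP; split; lra.
(* used for b = 1 and b = -1, which together bound the absolute value *)
have mono (b : R) : `|b| = 1 ->
    b * g x + - C * sqrt1m x <= b * g y + - C * sqrt1m y.
  move=> b1.
  have dh : has_deriv D (fun z => b * g z + - C * sqrt1m z)
      (fun z => b * g' z + C * expR (- (ln (1 - z) / 2))).
    apply: (has_deriv_eq (g := fun z => (0 * g z + b * g' z) +
      (0 * sqrt1m z + - C * - expR (- (ln (1 - z) / 2))))); last first.
      by move=> z _; rewrite !mul0r !add0r mulrNN.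
    have := has_derivD (has_derivM (has_deriv_cst b) dg)
      (has_derivM (has_deriv_cst (- C)) has_deriv_sqrt1m).
    by move=> d z /DI; apply: d.
  apply: (has_deriv_ge0 iD dh) => // z Dz.
  have := gC z Dz; have : - (b * g' z) <= `|g' z|.
    by rewrite -[`|g' z|]mul1r -b1 -normrM -normrN ler_norm.
  by move=> /le_trans H /H; rewrite -subr_ge0 opprK addrC.
rewrite mulrBr ler_norml.
have := mono 1 (normr1 _); have := mono (-1) (normrN1 _).
by rewrite !mul1r !mulN1r !mulNr => ? ?; apply/andP; split; lra.
Qed.

Lemma sqrt1m_bounds (x : R) : 2^-1 <= x < 1 -> 0 <= sqrt1m x <= 2.
Proof.
move=> /andP[x2 x1]; rewrite /sqrt1m mulr_ge0 ?expR_ge0 //=.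
rewrite -[leRHS]mulr1 ler_pM2l // -[leRHS]expR0 ler_expR.
have : ln (1 - x) <= 0 by rewrite ln_le0 //; lra.
by move=> ?; lra.
Qed.

Lemma log_bounded_primitive g g' : has_deriv I01 g g' -> log_bounded g' ->
  log_bounded g.
Proof.
move=> dg /(primitive_variation dg)[C C0 gC].
apply: (@bounded_log_bounded _ (`|g 2^-1| + C * 2)) => x hx.
rewrite -[g x](subrK (g 2^-1)) addrC.
apply: le_trans (ler_normD _ _) _; rewrite lerD2l.
have /andP[x2 x1] := hx.
apply: le_trans (gC _ _ (lexx _) x2 x1) _; rewrite ler_wpM2l //.
have /andP[? ?] := sqrt1m_bounds hx.
have /andP[? ?] : 0 <= sqrt1m 2^-1 <= 2.
  by apply: sqrt1m_bounds; apply/andP; split; lra.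
by lra.
Qed.

Lemma monotone_bounded_cvg g (M : R) :
  (forall x y, 2^-1 <= x -> x <= y -> y < 1 -> g x <= g y) ->
  (forall x, 2^-1 <= x < 1 -> g x <= M) -> cvg (g x @[x --> 1^'-]).
Proof.
move=> gm gM; apply: nondecreasing_at_left_is_cvgr.
  near=> a => x y; rewrite !in_itv /= => /andP[ax x1] /andP[ay y1] xy.
  apply: gm => //; apply: ltW; apply: le_lt_trans ax.
  by near: a; apply: nbhs_left_ge; lra.
near=> a; exists M => _ [y /= + <-]; rewrite in_itv /= => /andP[ay y1].
apply: gM; rewrite y1 andbT; apply: ltW; apply: le_lt_trans ay.
by near: a; apply: nbhs_left_ge; lra.
Unshelve. all: by end_near.
Qed.

(** Adding a multiple of [sqrt1m] turns the primitive into a bounded monotone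
    function, and [sqrt1m] is itself bounded and monotone. *)
Lemma log_bounded_primitive_cvg g g' : has_deriv I01 g g' -> log_bounded g' ->
  cvg (g x @[x --> 1^'-]).
Proof.
move=> dg lg'; have [C C0 gC] := primitive_variation dg lg'.
have sm x y : 2^-1 <= x -> x <= y -> y < 1 -> sqrt1m y <= sqrt1m x.
  move=> x2 xy y1; rewrite ler_pM2l // ler_expR ler_pM2r // ler_ln ?posrE; lra.
have cs : cvg (- sqrt1m x @[x --> 1^'-]).
  apply: (@monotone_bounded_cvg _ 0) => [x y ? ? ?|x /sqrt1m_bounds/andP[? _]].
    by rewrite lerN2 sm.
  by rewrite oppr_le0.
have [M gM] : exists M, forall x, 2^-1 <= x < 1 -> g x <= M.
  exists (g 2^-1 + C * 2) => x hx; have /andP[x2 x1] := hx.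
  rewrite -lerBlDl (le_trans (ler_norm _)) //.
  apply: le_trans (gC _ _ (lexx _) x2 x1) _; rewrite ler_wpM2l //.
  have /andP[? ?] := sqrt1m_bounds hx.
  have /andP[? ?] : 0 <= sqrt1m 2^-1 <= 2.
    by apply: sqrt1m_bounds; apply/andP; split; lra.
  by lra.
have cu : cvg (g x + C * - sqrt1m x @[x --> 1^'-]).
  apply: (@monotone_bounded_cvg _ M) => [x y x2 xy y1|x hx].
    have := gC x y x2 xy y1; rewrite ler_norml => /andP[+ _].
    by rewrite mulrBr !mulrN; lra.
  have /andP[s0 _] := sqrt1m_bounds hx; have := gM x hx.
  by have := mulr_ge0 C0 s0; rewrite mulrN; lra.
have -> : g = (fun x => (g x + C * - sqrt1m x) + - C * - sqrt1m x).
  by apply/funext => x; ring.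
by apply: is_cvgD => //; apply: is_cvgMr.
Qed.

End LogBounded.

(** * One-sided calculus on the unit interval *)

Section UnitInterval.
Variable R : realType.
Implicit Types (f g : R -> R).

Definition der01 f g := forall s : R, s \in `[0, 1] ->
  diff_quot f s t @[t --> within `[0, 1] s^'] --> g s.

Lemma within01_dnbhs_proper (s : R) : s \in `[0, 1] ->
  ProperFilter (within `[0, 1] s^').
Proof.
rewrite in_itv /= => /andP[s0 s1]; split; last exact: within_filter.
rewrite /within /= => /nbhs_ballP[e /= e0 He].
pose d := Num.min e 1 / 2.
have [d0 de d1] : [/\ 0 < d, d < e & d <= 2^-1].
  by rewrite /d; case: (leP e 1) => ?; split; lra.
have [s2|s2] := leP s 2^-1.
- apply: (He (s + d)).
  + by rewrite /ball /= opprD addNKr normrN gtr0_norm.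
  + by rewrite gt_eqF // ltrDl.
  + by rewrite /= in_itv /=; apply/andP; split; lra.
- apply: (He (s - d)).
  + by rewrite /ball /= opprB addrC subrK gtr0_norm.
  + by rewrite lt_eqF // gtrBl.
  + by rewrite /= in_itv /=; apply/andP; split; lra.
Qed.

Lemma der01_unique f g s : der01 f g -> s \in `[0, 1] -> deriv01 f s = g s.
Proof.
move=> dfg sI; have := within01_dnbhs_proper sI => PF.
by apply: cvg_lim => //; apply: dfg.
Qed.

Lemma has_deriv_der01 D f g : (forall s, s \in `[0, 1] -> D s) ->
  has_deriv D f g -> der01 f g.
Proof.
move=> subD df s sI; have [dfs <-] := df s (subD s sI).
apply: cvg_within_filter.
rewrite (_ : diff_quot f s = (fun h => h^-1 *: ((f \o shift s) (h *: 1) - f s)) \o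
  (fun t => t - s)); last first.
  apply/funext => t; rewrite /diff_quot /= /GRing.scale /= mulr1 subrK.
  by rewrite mulrC.
suff c0 : t - s @[t --> s^'] --> 0^' by exact: cvg_comp c0 dfs.
move=> A /=; rewrite /nbhs /= /within /= => A0.
have : \forall h \near (s - s), h != 0 -> A h by rewrite subrr.
have cs : t - s @[t --> s] --> s - s.
  by apply: cvgB; [exact: cvg_id|exact: cvg_cst].
move=> {}A0; near=> t.
have : t - s != 0 by rewrite subr_eq0; near: t; exact: nbhs_dnbhs_neq.
by near: t; exact: (@cvg_within_filter _ _ _ (nbhs s) _ _ _ cs) A0.
Unshelve. all: by end_near.
Qed.

Lemma der01_eq f f1 g g1 : (forall s, s \in `[0, 1] -> f s = f1 s) ->
  (forall s, s \in `[0, 1] -> g s = g1 s) -> der01 f g -> der01 f1 g1.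
Proof.
move=> ef eg dfg s sI; rewrite -eg //; apply: cvg_trans (dfg s sI).
apply: near_eq_cvg; near=> t; rewrite /diff_quot !ef //.
by near: t; apply: withinT; apply: dnbhs_filter.
Unshelve. all: by end_near.
Qed.

Lemma smooth_smooth01 D f : (forall s, s \in `[0, 1] -> D s) ->
  smooth D f -> smooth01 f.
Proof.
move=> subD Sf k.
suff H h f1 : (forall s, s \in `[0, 1] -> h s = f1 s) -> nderivable D k.+1 f1 ->
    forall s, s \in `[0, 1] ->
    cvg (diff_quot (iter k (@deriv01 R) h) s @ within `[0, 1] s^').
  exact: (H f f).
elim: k h f1 {f Sf} => [|k IHk] h f e [g df Cg] s sI;
  have dh := der01_eq (fun t tI => esym (e t tI)) (fun _ _ => erefl)
    (has_deriv_der01 subD df).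
  apply/cvg_ex; exists (g s).
  exact: dh.
rewrite iterSr; apply: (IHk _ g) => // t tI; exact: der01_unique dh tI.
Qed.

Lemma der01B a f f' g g' : der01 f f' -> der01 g g' ->
  der01 (fun s => f s - a * g s) (fun s => f' s - a * g' s).
Proof.
move=> df dg s sI.
rewrite (_ : diff_quot _ s = fun t => diff_quot f s t - a * diff_quot g s t).
  apply: cvgB; first exact: df.
  by apply: cvgM; [exact: cvg_cst|exact: dg].
by apply/funext => t; rewrite /diff_quot; ring.
Qed.

Lemma der01_continuous f g : der01 f g -> {within `[0, 1], continuous f}.
Proof.
move=> dfg; apply/subspace_continuousP => s sI.
have fs : f t @[t --> within `[0, 1] s^'] --> f s.
  have c0 : t - s @[t --> within `[0, 1] s^'] --> s - s.
    apply: (cvg_within_filter (F := s^')).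
    apply: (cvg_within_filter (F := nbhs s)).
    by apply: cvgB; [exact: cvg_id|exact: cvg_cst].
  have c : diff_quot f s t * (t - s) + f s @[t --> within `[0, 1] s^'] -->
      g s * (s - s) + f s.
    by apply: cvgD; [apply: cvgM => //; exact: dfg|exact: cvg_cst].
  rewrite subrr mulr0 add0r in c; apply: cvg_trans c; apply: near_eq_cvg.
  rewrite near_withinE; near=> t => _; rewrite /diff_quot /=.
  have ts : t - s != 0 by rewrite subr_eq0; near: t; exact: nbhs_dnbhs_neq.
  by rewrite divfK // subrK.
move=> A As; have := fs A As.
rewrite /= /nbhs /= /within /= => H; near=> t.
move=> tI; have [->|ts] := eqVneq t s; first exact: nbhs_singleton.
by move: ts tI; near: t.
Unshelve. all: by end_near.
Qed.

Lemma der01_is_derive f g (s : R) : der01 f g -> s \in `]0, 1[ ->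
  is_derive s 1 f (g s).
Proof.
move=> dfg sI.
have sI' : s \in `[0, 1] by apply: subset_itv_oo_cc.
suff c : h^-1 *: ((f \o shift s) (h *: 1) - f s) @[h --> 0^'] --> g s.
  by apply: DeriveDef; [apply/cvg_ex; exists (g s)|apply: cvg_lim].
rewrite (_ : (fun h => _) = diff_quot f s \o (fun h => h + s)); last first.
  apply/funext => h; rewrite /diff_quot /= /GRing.scale /= mulr1 addrK.
  by rewrite mulrC.
apply: cvg_comp (dfg s sI').
have ca : h + s @[h --> (0 : R)] --> 0 + s.
  by apply: cvgD; [exact: cvg_id|exact: cvg_cst].
have n01 : \forall t \near (0 + s), t \in `]0, 1[.
  by rewrite add0r; apply: near_in_itvoo.
move=> A; rewrite /= /nbhs /= /within /= => A0.
have {}A0 : \forall t \near (0 + s), t != s -> t \in `[0, 1] -> A t.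
  by rewrite add0r.
have ca' : h + s @[h --> 0^'] --> 0 + s by apply: cvg_within_filter.
near=> h.
have hs : h + s != s.
  by rewrite -subr_eq0 addrK; near: h; exact: nbhs_dnbhs_neq.
have hI : h + s \in `[0, 1].
  by apply: subset_itv_oo_cc; near: h; apply: ca' n01.
by move: hs hI; near: h; apply: ca' A0.
Unshelve. all: by end_near.
Qed.

Lemma der01_cst f g (s : R) : der01 f g -> (forall s, s \in `[0, 1] -> g s = 0) ->
  s \in `[0, 1] -> f s = f 0.
Proof.
move=> dfg g0 sI; have := sI; rewrite in_itv /= => /andP[].
rewrite le_eqVlt => /predU1P[<-//|s0 s1].
have sub : `[0, s] `<=` `[0, 1].
  by move=> x /=; rewrite !in_itv /= => /andP[-> xs]; apply: le_trans s1.
have [x xs||x xs E] := @MVT R f g 0 s s0.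
- apply: (der01_is_derive dfg).
  move: xs; rewrite !in_itv /= => /andP[-> xs].
  by apply: lt_le_trans s1.
- exact: continuous_subspaceW sub (der01_continuous dfg).
apply/eqP; rewrite -subr_eq0 E g0 ?mul0r //.
by apply: sub; apply: subset_itv_oo_cc.
Qed.

End UnitInterval.

(** * Uniqueness of primitives in the tensor product *)

Section TensorUniqueness.
Variables (R : realType) (U : algType R[i]).
Implicit Types (w v : R -> U).

Definition cat_fam T n m (f : 'I_n -> T) (g : 'I_m -> T) (i : 'I_(n + m)) : T :=
  match fintype.split i with inl j => f j | inr j => g j end.

Lemma cat_fam_l T n m (f : 'I_n -> T) (g : 'I_m -> T) j :
  cat_fam f g (lshift m j) = f j.
Proof. by rewrite /cat_fam (unsplitK (inl _ j)). Qed.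

Lemma cat_fam_r T n m (f : 'I_n -> T) (g : 'I_m -> T) j :
  cat_fam f g (rshift n j) = g j.
Proof. by rewrite /cat_fam (unsplitK (inr _ j)). Qed.

Lemma cat_famP T n m (f : 'I_n -> T) (g : 'I_m -> T) (P : T -> Prop) :
  (forall j, P (f j)) -> (forall j, P (g j)) -> forall j, P (cat_fam f g j).
Proof. by move=> Pf Pg j; rewrite /cat_fam; case: fintype.split. Qed.

Lemma tensor_deriv_ext w v w' v' : (forall s, s \in `[0, 1] -> w s = v s) ->
  (forall s, s \in `[0, 1] -> w' s = v' s) -> tensor_deriv w w' ->
  tensor_deriv v v'.
Proof.
move=> e e' [n [f [a [Sf E]]]]; exists n, f, a; split=> // s sI.
by rewrite -e // -e' //; apply: E.
Qed.

Lemma tensor_deriv_add w v w' v' : tensor_deriv w w' -> tensor_deriv v v' ->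
  tensor_deriv (fun s => w s + v s) (fun s => w' s + v' s).
Proof.
move=> [n [f [a [Sf E]]]] [m [g [b [Sg E']]]].
exists (n + m)%N, (cat_fam f g), (cat_fam a b); split=> [|s sI].
  exact: cat_famP.
rewrite !big_split_ord /=.
have [-> ->] := E s sI; have [-> ->] := E' s sI.
by split; congr +%R; apply: eq_bigr => j _; rewrite ?cat_fam_l ?cat_fam_r.
Qed.

(** As [U] carries no topology, constancy is proved on the coefficients. If the
    vectors are linearly independent every scalar derivative vanishes;
    otherwise one vector is eliminated, and the number of terms drops. *)
Lemma tensor_der01_cst n (f g : 'I_n -> R -> R) (a : 'I_n -> U) :
  (forall j, der01 (f j) (g j)) ->
  (forall s, s \in `[0, 1] -> \sum_j (g j s)%:C *: a j = 0) ->
  forall s, s \in `[0, 1] -> \sum_j (f j s)%:C *: a j = \sum_j (f j 0)%:C *: a j.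
Proof.
elim: n f g a => [|n IHn] f g a df g0 s sI; first by rewrite !big_ord0.
have [[c [k ck] c0]|indep] := pselect (exists2 c : 'I_n.+1 -> R,
    exists k, c k != 0 & \sum_j (c j)%:C *: a j = 0); last first.
  have gj0 j t : t \in `[0, 1] -> g j t = 0.
    move=> tI; apply: contrapT => gjt; apply: indep.
    by exists (fun j => g j t); [exists j; apply/eqP|exact: g0].
  by apply: eq_bigr => j _; rewrite (der01_cst (df j) (gj0 j) sI).
have ckC : (c k)%:C != 0 :> R[i] by rewrite fmorph_eq0.
have elim_k (h : 'I_n.+1 -> R) : \sum_j (h j)%:C *: a j =
    \sum_j (h (lift k j) - c (lift k j) / c k * h k)%:C *: a (lift k j).
  have ak : a k = - \sum_j (c (lift k j) / c k)%:C *: a (lift k j).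
    apply/(scalerI ckC)/eqP; rewrite -subr_eq0 scalerN opprK scaler_sumr.
    rewrite -[X in _ == X]c0 (bigD1_ord k) //=; apply/eqP; congr +%R.
    apply: eq_bigr => j _; rewrite scalerA -rmorphM /= mulrC divfK //.
  rewrite (bigD1_ord k) //= ak scalerN scaler_sumr -sumrN -big_split /=.
  apply: eq_bigr => j _; rewrite scalerA addrC -scalerBl -rmorphM -rmorphB /=.
  by rewrite [h k * _]mulrC.
rewrite (elim_k (fun j => f j s)) (elim_k (fun j => f j 0)).
apply: (IHn (fun j s => f (lift k j) s - c (lift k j) / c k * f k s)
  (fun j s => g (lift k j) s - c (lift k j) / c k * g k s)) => // [j|t tI].
  exact: der01B.
by rewrite -(elim_k (fun j => g j t)); apply: g0.
Qed.

(** Real coefficients suffice: a complex one splits over a and ['i *: a]. *)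
Definition real_tensor w w' := exists n (f g : 'I_n -> R -> R) (a : 'I_n -> U),
  (forall j, der01 (f j) (g j)) /\
  (forall s, s \in `[0, 1] -> w s = \sum_j (f j s)%:C *: a j /\
                              w' s = \sum_j (g j s)%:C *: a j).

Lemma smooth01_der01 (f : R -> R) : smooth01 f -> der01 f (deriv01 f).
Proof. by move=> Sf s sI; apply: (Sf 0%N). Qed.

Lemma complex_scale_split (z : R[i]) (a : U) :
  z *: a = (complex.Re z)%:C *: a + (complex.Im z)%:C *: ('i *: a).
Proof. by rewrite scalerA -scalerDl mulrC -complexE. Qed.

Lemma tensor_deriv_real w w' : tensor_deriv w w' -> real_tensor w w'.
Proof.
move=> [n [f [a [Sf E]]]].
exists (n + n)%N,
  (cat_fam (fun j s => complex.Re (f j s)) (fun j s => complex.Im (f j s))),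
  (cat_fam (fun j => deriv01 (fun s => complex.Re (f j s)))
           (fun j => deriv01 (fun s => complex.Im (f j s)))),
  (cat_fam a (fun j => 'i *: a j)); split=> [j|s sI].
  by rewrite /cat_fam; case: fintype.split => k; apply: smooth01_der01; case: (Sf k).
have [-> ->] := E s sI; rewrite !big_split_ord /=.
by split; rewrite -big_split; apply: eq_bigr => j _;
  rewrite complex_scale_split ?cat_fam_l ?cat_fam_r.
Qed.

Lemma real_tensor_sub w w' v v' : real_tensor w w' -> real_tensor v v' ->
  real_tensor (fun s => w s - v s) (fun s => w' s - v' s).
Proof.
move=> [n [f [g [a [df E]]]]] [m [f1 [g1 [b [df1 E1]]]]].
exists (n + m)%N, (cat_fam f f1), (cat_fam g g1), (cat_fam a (fun j => - b j)).
split=> [j|s sI]; first by rewrite /cat_fam; case: fintype.split.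
rewrite !big_split_ord /=.
have [-> ->] := E s sI; have [-> ->] := E1 s sI.
by split; rewrite -sumrN; congr +%R; apply: eq_bigr => j _;
  rewrite ?cat_fam_l ?cat_fam_r ?scalerN.
Qed.

Lemma tensor_deriv_unique w w' v v' : tensor_deriv w w' -> tensor_deriv v v' ->
  (forall s, s \in `[0, 1] -> w' s = v' s) -> w 0 = v 0 ->
  forall s, s \in `[0, 1] -> w s = v s.
Proof.
move=> /tensor_deriv_real dw /tensor_deriv_real dv e' e0 s sI.
have [n [f [g [a [df E]]]]] := real_tensor_sub dw dv.
have I0 : (0 : R) \in `[0, 1] by rewrite in_itv /= lexx ler01.
apply/eqP; rewrite -subr_eq0 (E s sI).1 (tensor_der01_cst df _ sI).
  by rewrite -(E 0 I0).1 e0 subrr.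
by move=> t tI; rewrite -(E t tI).2 e' // subrr.
Qed.

End TensorUniqueness.

(** * Tensors with real coefficients on the open interval *)

Section Tensors.
Variables (R : realType) (U : algType R[i]).

(** The span of the decomposable tensors with first factor in [S], inside the
    functions up to equality on [D]. As an inductive predicate it yields each
    closure property by induction on the sum. *)
Inductive tensor (T : Type) (D : set T) (S : (T -> R) -> Prop) : (T -> U) -> Prop :=
| tensor_scale f a : S f -> tensor D S (fun x => (f x)%:C *: a)
| tensor_add w v : tensor D S w -> tensor D S v -> tensor D S (fun x => w x + v x)
| tensor_ext w v : (forall x, D x -> w x = v x) -> tensor D S w -> tensor D S v.

Section TensTheory.
Variables (T : Type) (D : set T).
Implicit Types (S : (T -> R) -> Prop) (w v : T -> U).

Lemma tensor_mono S S' w : (forall f, S f -> S' f) -> tensor D S w -> tensor D S' w.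
Proof.
move=> SS'; elim=> [f a Sf|u v _ ? _ ?|u v e _ H].
- exact/tensor_scale/SS'.
- exact: tensor_add.
- exact: tensor_ext H.
Qed.

Lemma tensor_mul S w v : (forall f g, S f -> S g -> S (fun x => f x * g x)) ->
  tensor D S w -> tensor D S v -> tensor D S (fun x => w x * v x).
Proof.
move=> SM; elim=> {w} [f a Sf|w1 w2 _ H1 _ H2|w w1 e _ H] tv.
- elim: tv => {v} [g b Sg|v1 v2 _ H1 _ H2|v v1 e _ H].
  + apply: (@tensor_ext _ D S (fun x => (f x * g x)%:C *: (a * b))).
      by move=> x _; rewrite -scalerAl -scalerAr scalerA rmorphM.
    exact/tensor_scale/SM.
  + by apply: tensor_ext (tensor_add H1 H2) => x _; rewrite mulrDr.
  + by apply: tensor_ext H => x Dx; rewrite e.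
- by apply: tensor_ext (tensor_add (H1 tv) (H2 tv)) => x _; rewrite mulrDl.
- by apply: tensor_ext (H tv) => x Dx; rewrite e.
Qed.

Lemma tensor_cst S (a : U) : S (fun=> 1) -> tensor D S (fun=> a).
Proof.
by move=> S1; apply: tensor_ext (tensor_scale D a S1) => x _; rewrite scale1r.
Qed.

Lemma tensor_opp S w : tensor D S w -> tensor D S (fun x => - w x).
Proof.
elim=> {w} [f a Sf|w v _ H1 _ H2|w v e _ H].
- by apply: tensor_ext (tensor_scale D (- a) Sf) => x _; rewrite scalerN.
- by apply: tensor_ext (tensor_add H1 H2) => x _; rewrite opprD.
- by apply: tensor_ext H => x Dx; rewrite e.
Qed.

Lemma tensor_sum S n (w : 'I_n -> T -> U) : S (fun=> 1) ->
  (forall i, tensor D S (w i)) -> tensor D S (fun x => \sum_i w i x).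
Proof.
move=> S1; elim: n w => [|n IHn] w tw.
  by apply: tensor_ext (tensor_cst 0 S1) => x _; rewrite big_ord0.
apply: tensor_ext (tensor_add (tw ord0) (IHn _ (fun i => tw (lift ord0 i)))).
by move=> x _; rewrite big_ord_recl.
Qed.

Lemma tensor_comp T' (D' : set T') S (S1 : (T' -> R) -> Prop) (h : T' -> T) w :
  (forall x, D' x -> D (h x)) -> (forall f, S f -> S1 (fun x => f (h x))) ->
  tensor D S w -> tensor D' S1 (fun x => w (h x)).
Proof.
move=> DD SS; elim=> {w} [f a Sf|w v _ H1 _ H2|w v e _ H].
- exact: (tensor_scale D' a (SS _ Sf)).
- exact: tensor_add H1 H2.
- by apply: tensor_ext H => x Dx; rewrite e //; apply: DD.
Qed.

End TensTheory.

(** The graph of d/dx (x) id: as [U] has no topology, a derivative exists only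
    through the coefficients. *)
Inductive tder : (R -> U) -> (R -> U) -> Prop :=
| tder_scale f g a : has_deriv I01 f g -> smooth I01 g ->
    tder (fun x => (f x)%:C *: a) (fun x => (g x)%:C *: a)
| tder_add w w' v v' : tder w w' -> tder v v' ->
    tder (fun x => w x + v x) (fun x => w' x + v' x)
| tder_ext w w' v v' : (forall x, I01 x -> w x = v x) ->
    (forall x, I01 x -> w' x = v' x) -> tder w w' -> tder v v'.

Implicit Types (w v : R -> U).

Lemma tder_mul w w' v v' : tder w w' -> tder v v' ->
  tder (fun x => w x * v x) (fun x => w' x * v x + w x * v' x).
Proof.
elim=> {w w'} [f f' a df Sf|w1 w1' w2 w2' _ H1 _ H2|w w' w1 w1' e e' _ H] tv.
- elim: tv => {v v'} [g g' b dg Sg|v1 v1' v2 v2' _ H1 _ H2|v v' v1 v1' e e' _ H].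
  + apply: (@tder_ext (fun x => (f x * g x)%:C *: (a * b))
      (fun x => (f' x * g x + f x * g' x)%:C *: (a * b))).
    * by move=> x _; rewrite -scalerAl -scalerAr scalerA rmorphM.
    * move=> x _; rewrite rmorphD scalerDl !rmorphM.
      by rewrite -!scalerAl -!scalerAr !scalerA.
    * apply: tder_scale (has_derivM df dg) _.
      by apply: smoothD; apply: smoothM => //; apply: smooth_primitive; eassumption.
  + apply: tder_ext (tder_add H1 H2) => x _; rewrite ?mulrDr //.
    by rewrite addrACA.
  + by apply: tder_ext H => x Dx; rewrite e // e'.
- apply: tder_ext (tder_add (H1 tv) (H2 tv)) => x _; rewrite ?mulrDl //.
  by rewrite addrACA.
- by apply: tder_ext (H tv) => x Dx; rewrite e // e'.
Qed.

Lemma tder_cst (a : U) : tder (fun=> a) (fun=> 0).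
Proof.
apply: tder_ext (tder_scale a (has_deriv_cst 1) (smooth_cst I01 0)) => x _.
  by rewrite scale1r.
by rewrite scale0r.
Qed.

Lemma tder_sum n (w w' : 'I_n -> R -> U) : (forall i, tder (w i) (w' i)) ->
  tder (fun x => \sum_i w i x) (fun x => \sum_i w' i x).
Proof.
elim: n w w' => [|n IHn] w w' tw.
  by apply: tder_ext (tder_cst 0) => x _; rewrite big_ord0.
apply: tder_ext (tder_add (tw ord0) (IHn _ _ (fun i => tw (lift ord0 i)))).
  by move=> x _; rewrite big_ord_recl.
by move=> x _; rewrite big_ord_recl.
Qed.

Lemma tder_smooth w w' : tder w w' -> tensor I01 (smooth I01) w.
Proof.
elim=> {w w'} [f g a df Sg|w w' v v' _ H1 _ H2|w w' v v' e e' _ H].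
- exact/tensor_scale/(smooth_primitive df).
- exact: tensor_add.
- exact: tensor_ext H.
Qed.

Lemma tder_primitive w u : tensor I01 (smooth I01) w ->
  exists2 v, tder v w & v 2^-1 = u.
Proof.
move=> tw; suff [v tv] : exists v, tder v w.
  exists (fun x => v x + (u - v 2^-1)); last by rewrite addrC subrK.
  by apply: tder_ext (tder_add tv (tder_cst _)) => x _ //; rewrite addr0.
elim: tw => {w} [f a Sf|w w1 _ [v tv] _ [v1 tv1]|w w1 e _ [v tv]].
- have [g dg] := primitive01 Sf.
  by exists (fun x => (g x)%:C *: a); apply: tder_scale.
- by exists (fun x => v x + v1 x); apply: tder_add.
- by exists v; apply: tder_ext tv.
Qed.

Definition log_class (f : R -> R) := smooth I01 f /\ log_bounded f.
Definition limit_class (f : R -> R) := log_class f /\ cvg (f x @[x --> 1^'-]).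

(** An integrable singularity at 1 gives a primitive with a limit there. *)
Lemma tder_log_primitive w : tensor I01 log_class w ->
  exists2 v, tder v w & tensor I01 limit_class v.
Proof.
elim=> {w} [f a [Sf bf]|w w1 _ [v tv cv] _ [v1 tv1 cv1]|w w1 e _ [v tv cv]].
- have [g dg] := primitive01 Sf.
  exists (fun x => (g x)%:C *: a); first exact: tder_scale.
  apply: tensor_scale; split; last exact: log_bounded_primitive_cvg dg bf.
  by split; [exact: smooth_primitive dg Sf|exact: log_bounded_primitive dg bf].
- by exists (fun x => v x + v1 x); [exact: tder_add|exact: tensor_add].
- by exists v => //; apply: tder_ext tv.
Qed.

Lemma der01_0 : der01 (fun=> 0 : R) (fun=> 0).
Proof.
apply: (has_deriv_der01 (D := setT)) => // s _.
exact: is_derive_cst.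
Qed.

(** The two notions of derivative meet here: the usual one on the open interval
    and the one-sided one on the parameter interval of a path. *)
Lemma tder_comp (D : set R) (c p : R -> R) w w' :
  (forall s, s \in `[0, 1] -> D s) -> (forall s, D s -> I01 (c s)) ->
  has_deriv D c (fun s => p (c s)) -> smooth I01 p -> tder w w' ->
  tensor_deriv (fun s => w (c s)) (fun s => (p (c s))%:C *: w' (c s)).
Proof.
move=> sub DI dc Sp; elim=> {w w'} [f g a df Sg|w w' v v' _ H1 _ H2|w w' v v' e e' _ H].
- exists 1%N, (fun _ s => (f (c s))%:C), (fun=> a).
  have dfc := has_deriv_comp DI df dc.
  have S0 : smooth D (fun=> 0 : R) := smooth_cst _ _.
  split=> [_|s sI].
    split; last by apply: (smooth_smooth01 sub S0).
    apply: (smooth_smooth01 sub) => n; apply: nderivable_comp DI dc _ Sp.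
    exact: (smooth_primitive df Sg).
  rewrite !big_ord1; split=> //.
  rewrite /cderiv01 /= (der01_unique (has_deriv_der01 sub dfc) sI).
  by rewrite (der01_unique der01_0 sI) scalerA -rmorphM mulrC.
- by apply: tensor_deriv_ext (tensor_deriv_add H1 H2) => s sI //; rewrite scalerDr.
- apply: tensor_deriv_ext H => s /sub/DI Is; first by rewrite e.
  by rewrite e'.
Qed.

End Tensors.

(** * Formal power series with tensor coefficients *)

Section Fps.
Variables (R : realType) (U : algType R[i]).
Implicit Types (X Y : fps U).

Lemma fcoef_flambda0 X : (flambda * X) 0%N = 0.
Proof. by rewrite fcoefM big_ord1 /= mul0r. Qed.

Lemma fcoef_flambdaS X r : (flambda * X) r.+1 = X r.
Proof.
rewrite fcoefM big_ord_recl /= mul0r add0r big_ord_recl /= mul1r subSS subn0.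
by rewrite big1 ?addr0 // => i _; rewrite mul0r.
Qed.

Lemma fcoef_constM a X r : (fconst a * X) r = a * X r.
Proof.
rewrite fcoefM big_ord_recl /= subn0 big1 ?addr0 // => i _.
by rewrite mul0r.
Qed.

Lemma fcoef_Mconst a X r : (X * fconst a) r = X r * a.
Proof.
rewrite fcoefM big_ord_recr /= subnn big1 ?add0r // => i _.
by rewrite subn_eq0 leqNgt ltn_ord mulr0.
Qed.

Lemma flambda_comm X : X * flambda = flambda * X.
Proof.
apply/fpsP => -[|r]; first by rewrite fcoef_flambda0 fcoefM big_ord1 /= mulr0.
rewrite fcoef_flambdaS fcoefM !big_ord_recr /= subnn mulr0 addr0 subSnn mulr1.
rewrite big1 ?add0r // => i _; rewrite (_ : (_ == 1%N) = false) ?mulr0 //.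
by rewrite subSn ?(ltnW (ltn_ord i)) // eqSS subn_eq0 leqNgt ltn_ord.
Qed.

Lemma fexp0 B : fexp 0 B = 1 :> fps U.
Proof.
apply/fpsP => -[|r]; rewrite fcoef1 /=.
  by rewrite expr0 fact0 divr1 expr0 scale1r.
by rewrite expr0n /= mul0r scale0r.
Qed.

Lemma fexpD s t B : fexp (s + t) B = fexp s B * fexp t B :> fps U.
Proof.
apply/fpsP => r; rewrite fcoefM /= addrC exprDn mulr_suml scaler_suml.
apply: eq_bigr => i _; have ir : (i <= r)%N by rewrite -ltnS.
rewrite -scalerAl -scalerAr scalerA -exprD subnKC //; congr (_ *: _).
have f0 n : n`!%:R != 0 :> R[i] by rewrite pnatr_eq0 -lt0n fact_gt0.
rewrite -mulr_natr -(bin_fact ir) !natrM.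
have c0 : ('C(r, i))%:R != 0 :> R[i] by rewrite pnatr_eq0 -lt0n bin_gt0.
by field; rewrite !f0 c0.
Qed.

Lemma fexpN t B : fexp (- t) B = (fexp t B)^-1 :> fps U.
Proof.
apply: (mulIr (fexp_unit t B)).
by rewrite mulVr ?fexp_unit // -fexpD addNr fexp0.
Qed.

Lemma fexp_comm t z B :
  fexp t B * fconst (z *: B) = fconst (z *: B) * fexp t B :> fps U.
Proof.
apply/fpsP => r; rewrite fcoef_Mconst fcoef_constM /=.
move: (_ / _) => c; transitivity ((c * z) *: B ^+ r.+1).
  by rewrite -scalerAl -scalerAr scalerA exprSr.
by rewrite -scalerAl -scalerAr scalerA exprS mulrC.
Qed.

Definition fder (F F' : R -> fps U) :=
  forall r, tder (fun x => F x r) (fun x => F' x r).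

Lemma fder_mul F F' G G' : fder F F' -> fder G G' ->
  fder (fun x => F x * G x) (fun x => F' x * G x + F x * G' x).
Proof.
move=> dF dG r.
have := tder_sum (fun i : 'I_r.+1 => tder_mul (dF i) (dG (r - i)%N)).
by apply: tder_ext => x _ //; rewrite fcoefD !fcoefM -big_split.
Qed.

Lemma fder_cst (K : fps U) : fder (fun=> K) (fun=> 0).
Proof. by move=> r; apply: tder_cst. Qed.

Lemma fder_ext F G F' G' : (forall x, I01 x -> F x = G x) ->
  (forall x, I01 x -> F' x = G' x) -> fder F F' -> fder G G'.
Proof.
by move=> e e' dF r; apply: tder_ext (dF r) => x Ix; rewrite ?e ?e'.
Qed.

End Fps.

(** * Flows and parallel transport *)

Section Transport.
Variables (R : realType) (U : algType R[i]).

(** The velocity is a smooth function [p] of the position. This holds for the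
    affine and the exponential paths, and makes iterated derivatives of a
    composite with [c] again composites with [c]. *)
Definition autonomous_path (c : R -> R) := exists (D : set R) (p : R -> R),
  [/\ forall s, s \in `[0, 1] -> D s, forall s, D s -> I01 (c s),
      has_deriv D c (fun s => p (c s)) & smooth I01 p].

(** The equation gives the derivative of each coefficient in terms of the
    previous one. *)
Lemma is_transport_unique (G : R -> U) c W V :
  is_transport G c W -> is_transport G c V -> W 1 = V 1.
Proof.
move=> [W0 dW] [V0 dV]; apply/fpsP => r.
have I1 : (1 : R) \in `[0, 1] by rewrite in_itv /= lexx ler01.
suff : forall s, s \in `[0, 1] -> W s r = V s r by apply.
elim: r => [|r IHr]; apply: tensor_deriv_unique (dW _) (dV _) _ _.
- by move=> s _; rewrite -!mulrA !fcoef_flambda0.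
- by rewrite W0 V0.
- by move=> s sI; rewrite -!mulrA !fcoef_flambdaS !fcoef_constM IHr.
- by rewrite W0 V0.
Qed.

(** A solution on the whole open interval, invertible because its constant term
    is 1; transports are read off from its values at the end points. *)
Definition flow (G : R -> U) (F : R -> fps U) :=
  fder F (fun x => flambda * fconst (G x) * F x) /\
  forall x, I01 x -> F x 0%N = 1.

Lemma flow_unit G F x : flow G F -> I01 x -> F x \is a GRing.unit.
Proof. by move=> [_ F0] Ix; apply/fps_unit_coef0/F0. Qed.

Lemma transport_flow G F c : flow G F -> autonomous_path c ->
  transport G c = F (c 1) * (F (c 0))^-1.
Proof.
move=> flowF [D [p [sub DI dc Sp]]].
have [dF F0] := flowF.
have I0 : (0 : R) \in `[0, 1] by rewrite in_itv /= lexx ler01.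
pose W s := F (c s) * (F (c 0))^-1.
have tW : is_transport G c W.
  split; first by rewrite /W mulrV // (flow_unit flowF) //; apply/DI/sub.
  move=> r.
  have := tder_comp sub DI dc Sp (fder_mul dF (fder_cst (F (c 0))^-1) r).
  apply: tensor_deriv_ext => // s sI.
  rewrite mulr0 addr0 -!mulrA (der01_unique (has_deriv_der01 sub dc) sI).
  case: r => [|r]; first by rewrite !fcoef_flambda0 scaler0.
  by rewrite !fcoef_flambdaS !fcoef_constM -scalerAl.
rewrite -[RHS]/(W 1); apply: (is_transport_unique _ tW).
exact: (@xgetPex _ (fun=> 0) [set W | is_transport G c W] (ex_intro _ W tW)).
Qed.

Lemma affine_path_autonomous (delta epsilon : R) :
  I01 delta -> I01 (1 - epsilon) -> autonomous_path (affine_path delta epsilon).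
Proof.
move=> /andP[d0 d1] /andP[e0 e1].
exists [set s | I01 (affine_path delta epsilon s)], (fun=> 1 - delta - epsilon).
split=> //; last exact: smooth_cst.
  move=> s; rewrite in_itv /= => /andP[s0 s1]; rewrite /affine_path /I01 /=.
  (* a convex combination of the end points *)
  rewrite (_ : _ + _ = (1 - s) * delta + s * (1 - epsilon)); last by ring.
  have [->|s1'] := eqVneq s 1; first by apply/andP; split; lra.
  have {}s1 : 0 < 1 - s by rewrite subr_gt0 lt_neqAle s1' s1.
  apply/andP; split.
    by apply: ltr_pwDl; [apply: mulr_gt0|apply: mulr_ge0 => //; exact: ltW].
  have : s * (1 - epsilon) <= s by rewrite ler_piMr // ltW.
  have : (1 - s) * delta < 1 - s by rewrite gtr_pMr.
  by lra.
apply: has_deriv_eq (has_derivD (has_deriv_cst delta)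
  (has_derivM (@has_deriv_id _ _) (has_deriv_cst (1 - delta - epsilon)))) _.
by move=> x _; rewrite add0r mul1r mulr0 addr0.
Qed.

Lemma half_path_autonomous (epsilon : R) : 0 < epsilon <= 2^-1 ->
  autonomous_path (half_path epsilon).
Proof.
move=> /andP[e0 e2].
exists [set s | I01 (half_path epsilon s)], (fun x => ln (2 * epsilon) * (x + -1)).
split=> //.
- move=> s; rewrite in_itv /= => /andP[s0 s1]; rewrite /half_path /I01 /=.
  have l0 : ln (2 * epsilon) * s <= 0 by rewrite mulr_le0_ge0 // ln_le0 //; lra.
  have := expR_gt0 (ln (2 * epsilon) * s).
  have : expR (ln (2 * epsilon) * s) <= 1 by rewrite -[leRHS]expR0 ler_expR.
  by move=> ? ?; apply/andP; split; lra.
- pose E : set R := setT.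
  have dexp : has_deriv E (@expR R) (@expR R) by move=> y _; apply: is_derive_expR.
  have := has_derivD (has_deriv_cst 1) (has_derivM (has_deriv_cst (- 2^-1))
    (has_deriv_comp (D := [set s | I01 (half_path epsilon s)]) (fun _ _ => I) dexp
    (has_derivM (has_deriv_cst (ln (2 * epsilon))) (@has_deriv_id _ _)))).
  rewrite (_ : (fun x => 1 + _) = half_path epsilon); last first.
    by apply/funext => s; rewrite mulNr.
  move=> d; apply: has_deriv_eq d _ => s _; rewrite /half_path; ring.
- apply: smoothM; first exact: smooth_cst.
  by apply: smoothD; [exact: smooth_id|exact: smooth_cst].
Qed.

Lemma transport_affine G F (delta epsilon : R) : flow G F ->
  I01 delta -> I01 (1 - epsilon) ->
  transport G (affine_path delta epsilon) = F (1 - epsilon) * (F delta)^-1.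
Proof.
move=> flowF Id Ie; rewrite (transport_flow flowF (affine_path_autonomous Id Ie)).
rewrite /affine_path mul0r addr0; congr (F _ * _); ring.
Qed.

Lemma transport_half G F (epsilon : R) : flow G F -> F 2^-1 = 1 ->
  0 < epsilon <= 2^-1 -> transport G (half_path epsilon) = F (1 - epsilon).
Proof.
move=> flowF F1 e2; rewrite (transport_flow flowF (half_path_autonomous e2)).
have /andP[e0 _] := e2.
have -> : half_path epsilon 0 = 2^-1.
  by rewrite /half_path mulr0 expR0; lra.
have -> : half_path epsilon 1 = 1 - epsilon.
  by rewrite /half_path mulr1 lnK ?posrE ?mulr_gt0 //; field.
by rewrite F1 invr1 mulr1.
Qed.

(** Both flows compute the transport along the segment from 1/2 to x. *)
Lemma flow_unique G F H x : flow G F -> flow G H -> F 2^-1 = 1 -> H 2^-1 = 1 ->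
  I01 x -> F x = H x.
Proof.
move=> flowF flowH F1 H1 Ix.
have Ix' : I01 (1 - (1 - x)) by rewrite opprB addrC subrK.
have := transport_affine flowF (half01 R) Ix'.
rewrite (transport_affine flowH (half01 R) Ix') F1 H1 invr1 !mulr1.
by rewrite opprB addrC subrK.
Qed.

(** Pulled back along the segment from 1/2 to x, this becomes the uniqueness of
    primitives on the unit interval. *)
Lemma tder_unique (w v w' : R -> U) x : tder w w' -> tder v w' -> I01 x ->
  w x = v x + (w 2^-1 - v 2^-1).
Proof.
move=> dw dv Ix.
have Ix' : I01 (1 - (1 - x)) by rewrite opprB addrC subrK.
have [D [p [sub DI dc Sp]]] := affine_path_autonomous (half01 R) Ix'.
have dv' := tder_add dv (tder_cst (w 2^-1 - v 2^-1)).
have I1 : (1 : R) \in `[0, 1] by rewrite in_itv /= lexx ler01.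
have := tensor_deriv_unique (tder_comp sub DI dc Sp dw) (tder_comp sub DI dc Sp dv').
rewrite /affine_path mul0r addr0 => /(_ _ _ 1 I1).
rewrite (_ : 2^-1 + 1 * _ = x); last by field.
by apply=> [s _|]; [rewrite addr0|rewrite addrC subrK].
Qed.

(** The coefficients are iterated integrals from 1/2, since the factor lambda
    makes the equation triangular. *)
Lemma flow_exists G : tensor I01 (smooth I01) G ->
  exists2 F, flow G F & F 2^-1 = 1.
Proof.
move=> SG.
have /choice[prim primP] (w : R -> U) : exists v : R -> U,
    tensor I01 (smooth I01) w -> tder v w /\ v 2^-1 = 0.
  have [tw|ntw] := pselect (tensor I01 (smooth I01) w); last by exists w.
  by have [v dv v0] := tder_primitive 0 tw; exists v.
pose f r := iter r (fun w => prim (fun x => G x * w x)) (fun=> 1).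
have SGM w : tensor I01 (smooth I01) w ->
    tensor I01 (smooth I01) (fun x => G x * w x).
  by apply: tensor_mul SG => g h; apply: smoothM.
have Sf r : tensor I01 (smooth I01) (f r).
  elim: r => [|r /SGM/primP[/tder_smooth]//].
  exact/tensor_cst/smooth_cst.
exists (fun x => Fps (fun r => f r x)).
  split=> // -[|r].
    apply: tder_ext (tder_cst 1) => // x _.
    by rewrite -mulrA fcoef_flambda0.
  have [df _] := primP _ (SGM _ (Sf r)).
  apply: tder_ext df => // x _.
  by rewrite -mulrA fcoef_flambdaS fcoef_constM.
apply/fpsP => -[|r]; rewrite fcoef1 //=.
by have [_ ->] := primP _ (SGM _ (Sf r)).
Qed.

End Transport.

(** * The Knizhnik-Zamolodchikov connection *)

Section Gauge.
Variables (R : realType) (U : algType R[i]).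
Implicit Types (A B : U).

Lemma smooth_id01V : smooth I01 (fun x : R => x^-1).
Proof.
by apply: smoothV (@smooth_id _ _) => x /andP[x0 _]; rewrite gt_eqF.
Qed.

Lemma smooth_sub1V : smooth I01 (fun x : R => (x - 1)^-1).
Proof.
apply: smoothV; last exact: smoothD (@smooth_id _ _) (smooth_cst _ _).
by move=> x /andP[_ x1]; rewrite lt_eqF // subr_lt0.
Qed.

Lemma tensor_Gamma A B : tensor I01 (smooth I01) (Gamma B A).
Proof.
exact: tensor_add (tensor_scale _ A smooth_id01V) (tensor_scale _ B smooth_sub1V).
Qed.

Lemma tder_mirror (w w' : R -> U) : tder w w' ->
  tder (fun x => w (1 - x)) (fun x => - w' (1 - x)).
Proof.
have DI (x : R) : I01 x -> I01 (1 - x).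
  by move=> /andP[x0 x1]; apply/andP; split; lra.
have dc := @has_deriv_onem R I01.
elim=> {w w'} [f g a df Sg|w w' v v' _ H1 _ H2|w w' v v' e e' _ H].
- apply: (@tder_ext _ _ (fun x => (f (1 - x))%:C *: a)
    (fun x => (g (1 - x) * -1)%:C *: a)) => // [x _|].
    by rewrite mulrN1 rmorphN scaleNr.
  apply: tder_scale; first exact: has_deriv_comp DI df dc.
  apply: smoothM; last exact: smooth_cst.
  by move=> n; apply: nderivable_comp (fun=> -1) _ n DI dc (Sg n) (smooth_cst _ _).
- by apply: tder_ext (tder_add H1 H2) => x _ //; rewrite opprD.
- by apply: tder_ext H => x /DI Ix; rewrite ?e ?e'.
Qed.

(** Reversing the interval exchanges the two residues. *)
Lemma flow_mirror A B F : flow (Gamma A B) F ->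
  flow (Gamma B A) (fun x => F (1 - x)).
Proof.
move=> [dF F0]; split=> [r|x /andP[x0 x1]]; last first.
  by apply: F0; apply/andP; split; lra.
apply: tder_ext (tder_mirror (dF r)) => // x _.
rewrite -fcoefN -!mulrA -mulrN -mulNr; congr (fcoef (_ * (_ * _)) r).
apply/fpsP => -[|n]; rewrite /= ?oppr0 // /Gamma opprD addrC.
rewrite -!scaleNr -!rmorphN -!invrN.
by congr (_%:C *: _ + _%:C *: _); congr _^-1; ring.
Qed.

Lemma fder_fexp_ln B : fder (fun x : R => fexp (- ln (1 - x))%:C B)
  (fun x => flambda * fconst (((1 - x)^-1)%:C *: B) * fexp (- ln (1 - x))%:C B).
Proof.
have dl : has_deriv I01 (fun x : R => - ln (1 - x)) (fun x => (1 - x)^-1).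
  by apply: has_deriv_eq (has_derivN (@has_deriv_ln1m R)) _ => x _; rewrite opprK.
have Sl := smooth_onemV R.
pose c r (x : R) := (- ln (1 - x)) ^+ r / r`!%:R.
have Ec r (x : R) : (- ln (1 - x))%:C ^+ r / r`!%:R = (c r x)%:C :> R[i].
  by rewrite /c rmorphM rmorphXn fmorphV rmorph_nat.
have dc r : has_deriv I01 (c r.+1) (fun x => (1 - x)^-1 * c r x).
  have dX n : has_deriv I01 (fun x : R => (- ln (1 - x)) ^+ n.+1)
      (fun x => n.+1%:R * (- ln (1 - x)) ^+ n * (1 - x)^-1).
    elim: n => [|n IHn].
      by apply: has_deriv_eq dl _ => x _; rewrite expr0 !mul1r.
    rewrite (_ : (fun x : R => _) =
      fun x : R => - ln (1 - x) * (- ln (1 - x)) ^+ n.+1).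
      apply: has_deriv_eq (has_derivM dl IHn) _ => x _.
      by rewrite [n.+2%:R]mulrSr !exprS; ring.
    by apply/funext => x; rewrite exprS.
  apply: has_deriv_eq (has_derivM (dX r) (has_deriv_cst (r.+1`!%:R^-1))) _.
  move=> x _; rewrite mulr0 addr0 /c factS natrM invfM.
  have a0 : r.+1%:R != 0 :> R by rewrite pnatr_eq0.
  by move: (_ ^+ r) (_^-1) (r`!%:R^-1) (r.+1%:R) a0 => e i f a a0; field.
have Sc r : smooth I01 (c r).
  elim: r => [|r IHr]; last exact: smooth_primitive (dc r) (smoothM Sl IHr).
  rewrite (_ : c 0%N = fun=> 1); first exact: smooth_cst.
  by apply/funext => x; rewrite /c expr0 fact0 divr1.
case=> [|r].
  apply: tder_ext (tder_cst (1 : U)) => x _.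
    by rewrite /= expr0 fact0 divr1 expr0 scale1r.
  by rewrite -mulrA fcoef_flambda0.
apply: tder_ext (tder_scale (B ^+ r.+1) (dc r) (smoothM Sl (Sc r))) => x _.
  by rewrite /= Ec.
rewrite -mulrA fcoef_flambdaS fcoef_constM /= Ec -[RHS]scalerAl.
have -> : B * ((c r x)%:C *: B ^+ r) = (c r x)%:C *: B ^+ r.+1.
  by rewrite -scalerAr -exprS.
by rewrite scalerA rmorphM.
Qed.

(** Conjugating by the exponential removes the residue at 1: what is left of the
    connection is singular only through powers of the logarithm. *)
Lemma fder_gauge A B F : flow (Gamma B A) F ->
  fder (fun x => fexp (- ln (1 - x))%:C B * F x)
    (fun x => flambda * (fexp (- ln (1 - x))%:C B * fconst ((x^-1)%:C *: A)
       * fexp (ln (1 - x))%:C B * (fexp (- ln (1 - x))%:C B * F x))).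
Proof.
move=> [dF _]; apply: fder_ext (fder_mul (fder_fexp_ln B) dF) => // x _.
set E := fexp (- ln (1 - x))%:C B; set L := fexp (ln (1 - x))%:C B.
have -> : fconst (Gamma B A x) =
    fconst ((x^-1)%:C *: A) - fconst (((1 - x)^-1)%:C *: B) :> fps U.
  apply/fpsP => -[|n]; rewrite fcoefD fcoefN /= ?subrr // /Gamma.
  by rewrite -scaleNr -rmorphN -invrN opprB.
have LE : L * E = 1 by rewrite -fexpD -rmorphD subrr fexp0.
have EB := fexp_comm (- ln (1 - x))%:C ((1 - x)^-1)%:C B.
rewrite !mulrA -[X in _ = X * F x]mulrA LE mulr1 -mulrDl -/E.
congr (_ * F x); rewrite -!mulrA (mulrA E) flambda_comm -mulrA -mulrDr.
by congr (flambda * _); rewrite mulrBr EB addrC subrK.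
Qed.

End Gauge.

(** * Limits of the regularized coefficients *)

Section Limits.
Variables (R : realType) (U : algType R[i]).
Implicit Types (A B : U).

Lemma tensor_fmul (T : Type) (D : set T) (S : (T -> R) -> Prop)
    (X Y : T -> fps U) r :
  S (fun=> 1) -> (forall f g, S f -> S g -> S (fun x => f x * g x)) ->
  (forall k, (k <= r)%N -> tensor D S (fun x => X x k)) ->
  (forall k, (k <= r)%N -> tensor D S (fun x => Y x k)) ->
  tensor D S (fun x => (X x * Y x) r).
Proof.
move=> S1 SM tX tY; apply: tensor_sum => // i; apply: tensor_mul => //.
  by apply: tX; rewrite -ltnS.
by apply: tY; rewrite leq_subr.
Qed.

(** The coefficients of the inverse satisfy a recursion without division, as the
    constant term is 1. *)
Lemma tensor_finv (T : Type) (D : set T) (S : (T -> R) -> Prop) (X : T -> fps U) :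
  S (fun=> 1) -> (forall f g, S f -> S g -> S (fun x => f x * g x)) ->
  (forall x, D x -> X x 0%N = 1) ->
  (forall r, tensor D S (fun x => X x r)) ->
  forall r, tensor D S (fun x => (X x)^-1 r).
Proof.
move=> S1 SM X0 tX r.
have VX x : D x -> (X x)^-1 * X x = 1.
  by move=> Dx; rewrite mulVr // fps_unit_coef0 ?X0.
elim/ltn_ind: r => -[_|r IHr].
  apply: tensor_ext (tensor_cst D 1 S1) => x Dx.
  have := congr1 (fun z : fps U => z 0%N) (VX x Dx).
  by rewrite fcoefM big_ord1 fcoef1 X0 // mulr1.
have tsum := tensor_opp (tensor_sum (n := r.+1) S1 (fun i =>
  tensor_mul SM (IHr i (ltn_ord i)) (tX (r.+1 - i)%N))).
apply: tensor_ext tsum => x Dx.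
have := congr1 (fun z : fps U => z r.+1) (VX x Dx).
rewrite fcoefM big_ord_recr fcoef1 /= subnn X0 // mulr1 => /eqP.
by rewrite addr_eq0 => /eqP ->; rewrite opprK.
Qed.

Lemma log_class_cst (a : R) : log_class (fun=> a).
Proof.
split; first exact: smooth_cst.
by apply: (@bounded_log_bounded _ _ `|a|).
Qed.

Lemma log_classM (f g : R -> R) : log_class f -> log_class g ->
  log_class (fun x => f x * g x).
Proof.
by move=> [Sf bf] [Sg bg]; split; [exact: smoothM|exact: log_boundedM].
Qed.

Lemma log_class_lnX (b : R) k : log_class (fun x => (b * ln (1 - x)) ^+ k).
Proof.
elim: k => [|k IHk]; first exact: (log_class_cst 1).
rewrite (_ : (fun x => _) = fun x => (b * ln (1 - x)) * (b * ln (1 - x)) ^+ k).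
  apply: log_classM IHk; apply: log_classM; first exact: log_class_cst.
  by split; [exact: smooth_ln1m|exact: log_bounded_ln].
by apply/funext => x; rewrite exprS.
Qed.

Lemma limit_class_cst (a : R) : limit_class (fun=> a).
Proof. by split; [exact: log_class_cst|exact: is_cvg_cst]. Qed.

Lemma tensor_log_fexp (b : R) B r :
  tensor I01 (@log_class R) (fun x => (fexp (b * ln (1 - x))%:C B) r).
Proof.
apply: (@tensor_ext _ _ _ _ _
  (fun x => ((b * ln (1 - x)) ^+ r * r`!%:R^-1)%:C *: B ^+ r)).
  by move=> x _; rewrite /= rmorphM rmorphXn fmorphV rmorph_nat.
apply: (tensor_scale I01 (B ^+ r)
  (f := fun x : R => (b * ln (1 - x)) ^+ r * r`!%:R^-1)).
by apply: log_classM; [exact: log_class_lnX|exact: log_class_cst].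
Qed.

Lemma log_class_inv : log_class (fun x : R => x^-1).
Proof.
split; first exact: smooth_id01V.
apply: (@bounded_log_bounded _ _ 2) => x /andP[x2 x1].
have x0 : 0 < x by lra.
by rewrite gtr0_norm ?invr_gt0 // -[leRHS]invrK lef_pV2 ?posrE ?invr_gt0.
Qed.

(** At x = 1 - epsilon this is psi_epsilon(B,A), when [F] is the flow that is 1
    at 1/2. *)
Definition regularized B (F : R -> fps U) x := fexp (- ln (1 - x))%:C B * F x.

(** By the gauge transformation each coefficient is a primitive of products of
    powers of the logarithm with lower coefficients, which grow at most
    logarithmically by induction. The primitive that comes with a limit may be
    written with other vectors than the coefficient itself; they differ by a
    constant, by uniqueness. *)
Lemma tensor_regularized A B F : flow (Gamma B A) F ->
  forall r, tensor I01 (@limit_class R) (fun x => regularized B F x r).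
Proof.
move=> flowF; have dY := fder_gauge flowF; have [_ F0] := flowF.
have log1 : log_class (fun=> 1 : R) := log_class_cst 1.
elim/ltn_ind => -[_|r IHr].
  apply: tensor_ext (tensor_cst I01 1 (limit_class_cst 1)) => x Ix.
  rewrite /regularized fcoefM big_ord1 F0 //=.
  by rewrite expr0 fact0 divr1 scale1r expr0 mulr1.
have tlog : tensor I01 (@log_class R) (fun x =>
    (fexp (- ln (1 - x))%:C B * fconst ((x^-1)%:C *: A)
       * fexp (ln (1 - x))%:C B * regularized B F x) r).
  apply: tensor_fmul => // [|k _|k kr]; first exact: log_classM.
    apply: tensor_fmul => // [|j _|j _]; first exact: log_classM.
      apply: tensor_fmul => // [|i _|i _]; first exact: log_classM.
        by apply: tensor_ext (tensor_log_fexp (-1) B i) => x _; rewrite mulN1r.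
      case: i => [|i] /=; last exact: tensor_cst.
      exact: (tensor_scale I01 A log_class_inv).
    by apply: tensor_ext (tensor_log_fexp 1 B j) => x _; rewrite mul1r.
  by apply: tensor_mono (IHr k _) => // f [].
have [v dv limv] := tder_log_primitive tlog.
have dYr : tder (fun x => regularized B F x r.+1) (fun x =>
    (fexp (- ln (1 - x))%:C B * fconst ((x^-1)%:C *: A)
       * fexp (ln (1 - x))%:C B * regularized B F x) r).
  by apply: tder_ext (dY r.+1) => x _ //; rewrite fcoef_flambdaS.
pose k := regularized B F 2^-1 r.+1 - v 2^-1.
apply: tensor_ext (tensor_add limv (tensor_cst I01 k (limit_class_cst 1))) => x Ix.
by rewrite (tder_unique dYr dv Ix).
Qed.

Lemma norm_real (N : U -> R) (b : R) x : is_norm N -> N (b%:C *: x) = `|b| * N x.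
Proof.
move=> nN; have := norm_scale nN b%:C x.
rewrite normc_def /= expr0n /= addr0 sqrtr_sqr -rmorphM /=.
by move=> /(congr1 (@complex.Re R)).
Qed.

Lemma norm_ge0 (N : U -> R) x : is_norm N -> 0 <= N x.
Proof.
move=> nN; have N0 : N 0 = 0 by rewrite -(scale0r 0) (norm_real 0 0 nN) normr0 mul0r.
have := norm_triangle nN x ((-1)%:C *: x).
rewrite (norm_real _ _ nN) normrN1 mul1r.
by rewrite rmorphN1 scaleN1r subrr N0 -mulr2n pmulrn_lge0.
Qed.

(** One limit serves all norms, because it is taken in the coefficients. *)
Lemma tensor_limit (T : Type) (F : set_system T) (FF : Filter F) (D : set T)
    (w : T -> U) : F D -> tensor D (fun f => cvg (f x @[x --> F])) w ->
  exists l, forall N : U -> R, is_norm N -> N (w x - l) @[x --> F] --> (0 : R).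
Proof.
move=> FD; elim=> {w} [f a /cvg_ex[l fl]|w v _ [l wl] _ [m vm]|w v e _ [l wl]].
- exists (l%:C *: a) => N nN.
  rewrite (_ : (fun x => _) = fun x => `|f x - l| * N a); last first.
    by apply/funext => x; rewrite -scalerBl -rmorphB norm_real.
  rewrite -(mul0r (N a)); apply: cvgMl; apply/norm_cvg0P.
  by rewrite -(subrr l); apply: cvgB => //; exact: cvg_cst.
- exists (l + m) => N nN.
  apply: (@squeeze_cvgr _ _ _ _ (fun=> 0) (fun x => N (w x - l) + N (v x - m))).
  + near=> x; rewrite norm_ge0 //= opprD addrACA; exact: norm_triangle.
  + exact: cvg_cst.
  + by rewrite -(addr0 (0 : R)); apply: cvgD; [exact: wl|exact: vm].
- exists l => N nN; apply: cvg_trans (wl N nN); apply: near_eq_cvg.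
  by apply: filterS FD => x Dx; rewrite e.
Unshelve. all: by end_near.
Qed.

End Limits.

(** * The factorization and the associator *)

Section Factorization.
Variables (R : realType) (U : algType R[i]).
Implicit Types (A B : U).

Lemma psi_flow A B F (epsilon : R) : flow (Gamma B A) F -> F 2^-1 = 1 ->
  0 < epsilon <= 2^-1 -> psi epsilon B A = regularized B F (1 - epsilon).
Proof.
move=> flowF F1 e2; rewrite /psi (transport_half flowF F1 e2) -fexpN -rmorphN.
by rewrite /regularized subKr.
Qed.

Lemma itv_quarter (e : R) : e \in `]0, 1 / 4] -> 0 < e <= 2^-1.
Proof. by rewrite in_itv /= => /andP[? ?]; apply/andP; split; lra. Qed.

Lemma I01_half (e : R) : 0 < e <= 2^-1 -> I01 e /\ I01 (1 - e).
Proof. by move=> /andP[? ?]; split; apply/andP; split; lra. Qed.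

Lemma cvg_onem_at_left (T : Type) (F : set_system T) (FF : Filter F)
    (h : T -> R) : h x @[x --> F] --> (0 : R) -> F [set x | 0 < h x] ->
  1 - h x @[x --> F] --> 1^'-.
Proof.
move=> h0 hpos.
have c1 : 1 - h x @[x --> F] --> (1 : R).
  by rewrite -[X in _ --> X](subr0 1); apply: cvgB => //; exact: cvg_cst.
move=> P; rewrite /= /nbhs /= /within /= => P1.
have {}c1 : F [set x | 1 - h x < 1 -> P (1 - h x)] := c1 _ P1.
suff : F [set x | P (1 - h x)] by [].
by apply: filterS2 c1 hpos => x /= + hx; apply; rewrite gtrBl.
Qed.

End Factorization.

Theorem theorem20 (R : realType) (U : algType R[i]) (A B : U) :
  (forall delta epsilon : R,
     delta \in `]0, 1 / 4] -> epsilon \in `]0, 1 / 4] ->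
     transport (Gamma B A) (affine_path delta epsilon) =
     fexp (ln epsilon)%:C B * PhiDE delta epsilon A B
       * fexp (- ln delta)%:C A) /\
  (exists Phi : fps U, forall N : U -> R, is_norm N -> forall r : nat,
     N (PhiDE p.1 p.2 A B r - Phi r)
       @[p --> within (`]0, 1 / 4] `*` `]0, 1 / 4]) (nbhs ((0, 0) : R * R))]
       --> (0 : R)).
Proof.
have [F flowF F1] := flow_exists (tensor_Gamma A B).
(* the flow of the connection with A and B exchanged *)
have [H flowH H1] := flow_exists (tensor_Gamma B A).
split=> [delta epsilon /itv_quarter d2 /itv_quarter e2|].
  have [Id Id'] := I01_half d2; have [Ie Ie'] := I01_half e2.
  have HF : H (1 - delta) = F delta.
    apply/esym; apply: flow_unique flowF (flow_mirror flowH) F1 _ Id.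
    by rewrite (_ : 1 - 2^-1 = 2^-1) //; field.
  have uF := flow_unit flowF Id.
  rewrite (transport_affine flowF Id Ie') /PhiDE (psi_flow flowF F1 e2).
  rewrite (psi_flow flowH H1 d2) /regularized HF !subKr.
  rewrite !rmorphN !fexpN.
  rewrite invrM ?unitrV ?fexp_unit // invrK.
  by rewrite !mulrA mulrV ?fexp_unit // mul1r -!mulrA mulrV ?fexp_unit // mulr1.
pose Q : set (R * R) := `]0, 1 / 4] `*` `]0, 1 / 4].
pose Fl := within Q (nbhs ((0, 0) : R * R)).
pose S (f : R * R -> R) := cvg (f p @[p --> Fl]).
have FQ : Fl Q by apply: withinT.
have S1 : S (fun=> 1) by apply: is_cvg_cst.
have SM f g : S f -> S g -> S (fun p => f p * g p) by apply: is_cvgM.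
have tpull (h : R * R -> R) (C D : U) G : h p @[p --> Fl] --> (0 : R) ->
    (forall p, Q p -> 0 < h p <= 2^-1) -> flow (Gamma D C) G -> G 2^-1 = 1 ->
    forall r, tensor Q S (fun p => psi (h p) D C r).
  move=> h0 hQ flowG G1 r.
  have hl : 1 - h p @[p --> Fl] --> 1^'-.
    by apply: cvg_onem_at_left => //; apply: filterS FQ => p /hQ/andP[].
  apply: tensor_ext (tensor_comp (h := fun p => 1 - h p) (D' := Q) (S1 := S) _ _
    (tensor_regularized flowG r))
    => [p /hQ hp|p /hQ/I01_half[]//|f [_ /cvg_ex[l fl]]].
    by rewrite (psi_flow flowG G1 hp).
  by apply/cvg_ex; exists l; apply: cvg_comp hl fl.
have c1 : p.1 @[p --> Fl] --> (0 : R).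
  by apply: cvg_within_filter; apply: (@cvg_fst _ _ (nbhs (0 : R)) (nbhs (0 : R))).
have c2 : p.2 @[p --> Fl] --> (0 : R).
  by apply: cvg_within_filter; apply: (@cvg_snd _ _ (nbhs (0 : R)) (nbhs (0 : R))).
have q1 p : Q p -> 0 < p.1 <= 2^-1 by move=> [/itv_quarter].
have q2 p : Q p -> 0 < p.2 <= 2^-1 by move=> [_ /itv_quarter].
have tPhi r : tensor Q S (fun p => PhiDE p.1 p.2 A B r).
  apply: tensor_fmul => // k _; first exact: tpull c2 q2 flowF F1 k.
  apply: tensor_finv => // [p /q1 hp|n]; last exact: tpull c1 q1 flowH H1 n.
  rewrite (psi_flow flowH H1 hp) /regularized fcoefM big_ord1 /=.
  have [_ Ip] := I01_half hp; have [_ H0] := flowH.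
  by rewrite H0 // expr0 fact0 divr1 scale1r expr0 mulr1.
have [Phi PhiP] := choice (fun r => tensor_limit _ FQ (tPhi r)).
by exists (Fps Phi) => N nN r; apply: PhiP.
Qed.
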